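(* Let $P=P^*\in L(\mathcal H)$ be a bounded self-adjoint operator, assume that $K$ is coercive and that $\operatorname{ran}[A\;B]=\{Ax+Bu: x\in\operatorname{dom}A,\ u\in\mathcal U\}$ is closed in $\mathcal H$. Then there exist $\gamma>0$ and $w\in\mathcal H$ such that the optimal control problem (OCP) is strictly pre-dissipative at some controlled equilibrium with storage function $V_{\gamma P,w}(x)=\langle\gamma Px,x\rangle+2\operatorname{Re}\langle w,x\rangle$ if and only if there exist $\eta,m>0$ such that for all $x\in\operatorname{dom}A$ $$\|Cx\|^2-2\eta\operatorname{Re}\langle Ax,Px\rangle\ \ge\ m\|x\|^2 .$$ In this case, the controlled equilibrium $(x_e,u_e)$ can be chosen as the minimizer of the optimal steady state problem $$\min_{x\in\operatorname{dom}A,\,u\in\mathcal U}\ell(x,u)\quad\text{s.t. }Ax+Bu=0 .$$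
   Context: Setting: $\mathcal H,\mathcal U,\mathcal Y,\mathcal Z$ are Hilbert spaces (real or complex, over the same field), $A$ generates a $C_0$-semigroup on $\mathcal H$, and $B\in L(\mathcal U,\mathcal H)$, $C\in L(\mathcal H,\mathcal Y)$, $K\in L(\mathcal U,\mathcal Z)$ are bounded linear operators, $z\in\mathcal H$, $v\in\mathcal U$. It is assumed that there is $c_K>0$ with $\|Ku\|\ge c_K\|Bu\|$ for all $u\in\mathcal U$. The operator $K$ is called coercive if $K^*K$ is strictly positive, i.e. there is $c>0$ with $\langle K^*Ku,u\rangle\ge c\|u\|^2$ for all $u\in\mathcal U$. The optimal control problem (OCP) is $$\min_{u\in L^2(0,T;\mathcal U)}\int_0^T\ell(x,u)\,dt\quad\text{s.t. }\dot x=Ax+Bu,\ x(0)=x_0,$$ with $\ell(x,u)=\|Cx\|^2+\|Ku\|^2+2\operatorname{Re}\langle z,x\rangle+2\operatorname{Re}\langle v,u\rangle$. A controlled equilibrium is a pair $(x_e,u_e)\in\operatorname{dom}A\times\mathcal U$ with $Ax_e+Bu_e=0$. $\mathcal K$ is the set of continuous strictly increasing functions $\alpha:[0,\infty)\to[0,\infty)$ with $\alpha(0)=0$. A storage function is a (Fréchet, real-linear derivative) $C^1$-function $V:\mathcal H\to\mathbb R$. The OCP is strictly pre-dissipative at a controlled equilibrium $(x_e,u_e)$ with storage function $V$ if there is a dissipation rate $\alpha\in\mathcal K$ such that for all $x\in\operatorname{dom}A$ and $u\in\mathcal U$: $V'(x)(Ax+Bu)\le\ell(x,u)-\ell(x_e,u_e)-\alpha(\|x-x_e\|)$.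 *)

(* Defs.v *)
From HB Require Import structures.
From mathcomp Require Import all_boot all_order all_algebra sesquilinear.
From mathcomp Require Import complex.
From mathcomp Require Import boolp classical_sets reals topology normedtype.

Set Implicit Arguments.
Unset Strict Implicit.
Unset Printing Implicit Defensive.

Import Order.TTheory GRing.Theory Num.Theory.
Import numFieldNormedType.Exports.

Local Open Scope classical_set_scope.
Local Open Scope ring_scope.

Variant scalar_kind := RealScalars | ComplexScalars.

Definition scalar (R : realType) (k : scalar_kind) : numFieldType :=
  match k with RealScalars => R | ComplexScalars => R[i] end.

Definition sRe (R : realType) (k : scalar_kind) : scalar R k -> R :=
  match k with RealScalars => fun a => a | ComplexScalars => @complex.Re R end.

Definition sconj (R : realType) (k : scalar_kind) :
    scalar R k -> scalar R k :=
  match k with RealScalars => fun a => a | ComplexScalars => @conjc R end.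

Definition of_real (R : realType) (k : scalar_kind) : R -> scalar R k :=
  match k with
  | RealScalars => fun a => a
  | ComplexScalars => fun a => Complex a 0
  end.
Arguments of_real {R k} a.

(* The inner product is linear in its first argument. *)
HB.mixin Record CompleteNormedModule_isHilbert (R : realType)
    (k : scalar_kind) H & CompleteNormedModule (scalar R k) H := {
  inner : {dot H for @sconj R k};
  inner_norm : forall x : H, inner x x = `|x| ^+ 2
}.

#[short(type="hilbertType")]
HB.structure Definition Hilbert (R : realType) (k : scalar_kind) :=
  {H of CompleteNormedModule (scalar R k) H
      & CompleteNormedModule_isHilbert R k H}.

Section Hilbert_notions.
Context {R : realType} {k : scalar_kind}.

(* [ `|x| ] lives in the scalar field, where it is a nonnegative real. *)
Definition hnorm {H : hilbertType R k} (x : H) : R := sRe `|x|.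

Definition re_inner {H : hilbertType R k} (x y : H) : R := sRe (inner x y).

Definition is_adjoint {H G : hilbertType R k} (T : H -> G) (T' : G -> H) :=
  forall x y, inner (T x) y = inner x (T' y).

Definition self_adjoint {H : hilbertType R k} (T : H -> H) := is_adjoint T T.

Definition strictly_positive {H : hilbertType R k} (T : H -> H) :=
  exists2 c : R, 0 < c & forall x, c * hnorm x ^+ 2 <= re_inner (T x) x.

Definition coercive {H G : hilbertType R k} (T : {linear H -> G}) :=
  exists T' : {linear G -> H},
    [/\ continuous T', is_adjoint T T' & strictly_positive (T' \o T)].

(* Only nonnegative times are relevant. *)
Record C0_semigroup {H : hilbertType R k} (S : R -> {linear H -> H}) : Prop := {
  semigroup_continuous : forall t, 0 <= t -> continuous (S t);
  semigroup0 : forall x, S 0 x = x;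
  semigroupD : forall s t x, 0 <= s -> 0 <= t -> S (s + t) x = S s (S t x);
  semigroup_strong : forall x, S t x @[t --> (0 : R)^'+] --> x
}.

Definition diff_quotient {H : hilbertType R k} (S : R -> {linear H -> H})
    (x : H) (t : R) : H := of_real t^-1 *: (S t x - x).

(* An unbounded operator is a total function together with its domain; its
   values outside the domain are irrelevant. *)
Definition generates_C0_semigroup {H : hilbertType R k}
    (domA : set H) (A : H -> H) :=
  exists S : R -> {linear H -> H},
    [/\ C0_semigroup S,
        domA = [set x | cvg (diff_quotient S x t @[t --> (0 : R)^'+])]
      & forall x, domA x -> diff_quotient S x t @[t --> (0 : R)^'+] --> A x].

Definition real_linear {H : hilbertType R k} (L : H -> R) :=
  (forall x y, L (x + y) = L x + L y) /\
  (forall (a : R) x, L (of_real a *: x) = a * L x).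

(* Over the complex numbers the library's differential does not apply: the
   derivative of a real-valued function is only real-linear. *)
Definition frechet_derivative {H : hilbertType R k} (V : H -> R) (x : H)
    (L : H -> R) :=
  [/\ real_linear L, continuous L
    & forall e : R, 0 < e -> \forall h \near (0 : H),
        `|V (x + h) - V x - L h| <= e * hnorm h].

(* Continuity of [V'] is with respect to the operator norm. *)
Definition C1_with_derivative {H : hilbertType R k} (V : H -> R)
    (V' : H -> H -> R) :=
  (forall x, frechet_derivative V x (V' x)) /\
  (forall x (e : R), 0 < e -> \forall y \near x,
     forall h, `|V' y h - V' x h| <= e * hnorm h).

Definition class_K (alpha : R -> R) :=
  [/\ {within [set r : R | 0 <= r], continuous alpha},
      forall r, 0 <= r -> 0 <= alpha r,
      forall r s, 0 <= r -> r < s -> alpha r < alpha s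
    & alpha 0 = 0].

Definition stage_cost {H U Y Z : hilbertType R k} (C : H -> Y) (K : U -> Z)
    (z : H) (v : U) (x : H) (u : U) : R :=
  hnorm (C x) ^+ 2 + hnorm (K u) ^+ 2 + 2 * re_inner z x + 2 * re_inner v u.

Definition controlled_equilibrium {H U : hilbertType R k} (domA : set H)
    (A : H -> H) (B : U -> H) (xe : H) (ue : U) :=
  domA xe /\ A xe + B ue = 0.

Definition strictly_pre_dissipative {H U : hilbertType R k} (domA : set H)
    (A : H -> H) (B : U -> H) (ell : H -> U -> R) (xe : H) (ue : U)
    (V : H -> R) :=
  controlled_equilibrium domA A B xe ue /\
  exists (V' : H -> H -> R) (alpha : R -> R),
    [/\ C1_with_derivative V V', class_K alpha
      & forall x u, domA x ->
          V' x (A x + B u) <= ell x u - ell xe ue - alpha (hnorm (x - xe))].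

Definition quadratic_storage {H : hilbertType R k} (Q : H -> H) (w x : H) : R :=
  re_inner (Q x) x + 2 * re_inner w x.

Definition steady_state_minimizer {H U : hilbertType R k} (domA : set H)
    (A : H -> H) (B : U -> H) (ell : H -> U -> R) (xe : H) (ue : U) :=
  controlled_equilibrium domA A B xe ue /\
  forall x u, controlled_equilibrium domA A B x u -> ell xe ue <= ell x u.

End Hilbert_notions.

(* Main.v *)
Require Import Defs.
From HB Require Import structures.
From mathcomp Require Import all_boot all_order all_algebra sesquilinear.
From mathcomp Require Import complex.
From mathcomp Require Import boolp classical_sets reals topology normedtype.
From mathcomp Require Import ring lra.

Set Implicit Arguments.
Unset Strict Implicit.
Unset Printing Implicit Defensive.

Import Order.TTheory GRing.Theory Num.Theory.
Import numFieldNormedType.Exports.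

Local Open Scope classical_set_scope.
Local Open Scope ring_scope.

(** The stage cost is convex and quadratic, so at a steady state optimum [(xe, ue)]
    that admits a Lagrange multiplier [w] for the constraint [A x + B u = 0] it has
    the exact expansion
    [l(x, u) - l(xe, ue) = 2 Re <w, A x + B u> + |C dx|^2 + |K du|^2], where
    [dx = x - xe] and [du = u - ue] ([multiplier_stage_cost]).  The term with [w] is
    the derivative of the linear function [2 Re <w, x>] along the dynamics, hence a
    storage function with that linear part reduces strict pre-dissipativity to an
    inequality in [dx] and [du] alone.  It follows from the operator inequality and a
    Young estimate if [gamma] is a small multiple of [eta]
    ([multiplier_pre_dissipative]).  Conversely, adding the dissipation inequalities
    at [xe + h] and [xe - h] removes all terms of first order in [h] and leaves the
    operator inequality ([pre_dissipative_operator_inequality]).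

    The substance is the existence of the optimum together with its multiplier
    ([Lagrange_multiplier], [steady_state_multiplier]).  On a steady state
    [A x = - B u], so the operator inequality bounds [x] by [C x] and [u], and the
    cost is coercive although [C] need not be.  Optimum and multiplier are obtained
    together as limits of penalised problems, in which the constraint is replaced by
    [n |A x + B u|^2].  The penalised minimisers exist by the Riesz representation
    theorem on the graph of [[A B]]; this graph is closed because generators are
    closed ([generator_closed]).  The approximate multipliers [- n (A x_n + B u_n)]
    lie in the range of [[A B]].  As this range is closed, the uniform boundedness
    principle bounds its vectors by their effect through the adjoint of [[A B]]
    ([range_bounded_below]), and so the approximate multipliers converge. *)

(** * Elementary facts about real numbers *)

Section RealNumbers.
Context {R : realType}.
Implicit Types a b c : R.

Lemma discriminant_le a b c : 0 <= c ->
  (forall t, 0 <= a + 2 * t * b + t ^+ 2 * c) -> b ^+ 2 <= a * c.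
Proof.
rewrite le_eqVlt => /orP[/eqP <- h|c0 h].
- have [->|b0] := eqVneq b 0; first by rewrite expr0n mulr0.
  have := h (- (a + 1) / (2 * b)); rewrite mulr0 addr0.
  have -> : 2 * (- (a + 1) / (2 * b)) * b = - (a + 1) by field.
  lra.
- have := h (- b / c).
  have -> : a + 2 * (- b / c) * b + (- b / c) ^+ 2 * c = (a * c - b ^+ 2) / c.
    by field; rewrite gt_eqF.
  by rewrite pmulr_lge0 ?invr_gt0 // subr_ge0.
Qed.

Lemma quadratic_lower_bound a b c : 0 <= a -> 0 <= b -> c ^+ 2 <= a * b ->
  - a <= b + 2 * c.
Proof.
move=> a0 b0 cab; rewrite leNgt; apply/negP => h.
have : 0 < (- (2 * c) - (a + b)) * (- (2 * c) + (a + b)) by apply: mulr_gt0; lra.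
by have := sqr_ge0 (a - b); lra.
Qed.

(** Minimising sequences and penalised minimisers converge at the rate [c / n.+1]
    below; this takes their identities to the limit. *)
Lemma harmonic_le0 a c : (forall n, a <= c / n.+1%:R) -> a <= 0.
Proof.
move=> h; rewrite leNgt; apply/negP => a0.
have := h (Num.truncn (c / a)); rewrite ler_pdivlMr //.
have := truncnS_gt (c / a); rewrite ltr_pdivrMr // mulrC => /lt_le_trans hh /hh.
by rewrite ltxx.
Qed.

End RealNumbers.

(** * The real structure of a real or complex Hilbert space

    Norms and inner products take values in the field of scalars.  Only their
    real parts enter the theorem, so the two kinds of scalars are distinguished
    here for the last time: afterwards the spaces are used as real inner product
    spaces, with scalars [of_real a]. *)

Section Scalars.
Context {R : realType} {k : scalar_kind}.
Implicit Types (a b : Defs.scalar R k) (r s : R).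

Lemma sReD a b : sRe (a + b) = sRe a + sRe b.
Proof. by case: k a b => //= -[? ?] [? ?]. Qed.

Lemma sRe_conj a : sRe (sconj a) = sRe a.
Proof. by case: k a => //= -[]. Qed.

Lemma sRe_of_realM r a : sRe (of_real r * a) = r * sRe a.
Proof. by case: k a => //= -[? ?] /=; rewrite mul0r subr0. Qed.

Lemma of_realK r : sRe (of_real r : Defs.scalar R k) = r.
Proof. by case: k. Qed.

Lemma sReK a : 0 <= a -> of_real (sRe a) = a.
Proof. by case: k a => //= -[x y]; rewrite lecE /= => /andP[/eqP->]. Qed.

Lemma of_realD r s : of_real (r + s) = of_real r + of_real s :> Defs.scalar R k.
Proof. by case: k => //=; apply/eqP; rewrite eq_complex /= addr0 !eqxx. Qed.

Lemma of_realM r s : of_real (r * s) = of_real r * of_real s :> Defs.scalar R k.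
Proof.
case: k => //=; apply/eqP.
by rewrite eq_complex /= !mul0r !mulr0 subr0 addr0 !eqxx.
Qed.

Lemma of_realN r : of_real (- r) = - of_real r :> Defs.scalar R k.
Proof. by case: k => //=; apply/eqP; rewrite eq_complex /= oppr0 !eqxx. Qed.

Lemma of_real1 : of_real 1 = 1 :> Defs.scalar R k.
Proof. by case: k. Qed.

Lemma of_real_le r s : (of_real r <= of_real s :> Defs.scalar R k) = (r <= s).
Proof. by case: k => //=; rewrite lecE /= eqxx. Qed.

Lemma of_real_lt r s : (of_real r < of_real s :> Defs.scalar R k) = (r < s).
Proof. by case: k => //=; rewrite ltcE /= eqxx. Qed.

Lemma of_real0 : of_real 0 = 0 :> Defs.scalar R k.
Proof. by case: k. Qed.

Lemma norm_of_real r : `|of_real r| = of_real `|r| :> Defs.scalar R k.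
Proof.
case: k => //=; rewrite normc_def /= expr0n addr0.
by rewrite sqrtr_sqr.
Qed.

End Scalars.

Section RealStructure.
Context {R : realType} {k : scalar_kind} {H : hilbertType R k}.
Implicit Types (x y w : H) (a : R).

Lemma re_innerDl x y w : re_inner (x + y) w = re_inner x w + re_inner y w.
Proof. by rewrite /re_inner linearDl sReD. Qed.

Lemma re_innerC x y : re_inner x y = re_inner y x.
Proof.
by rewrite /re_inner (hermitian_subproof x y) expr0 mul1r sRe_conj.
Qed.

Lemma re_innerZl a x y : re_inner (of_real a *: x) y = a * re_inner x y.
Proof. by rewrite /re_inner linearZl_LR sRe_of_realM. Qed.

Lemma of_real_hnorm x : of_real (hnorm x) = `|x|.
Proof. exact/sReK/normr_ge0. Qed.

Lemma re_inner_hnorm x : re_inner x x = hnorm x ^+ 2.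
Proof.
by rewrite /re_inner inner_norm -of_real_hnorm expr2 -of_realM of_realK.
Qed.

Lemma hnorm_ge0 x : 0 <= hnorm x.
Proof. by rewrite -(@of_real_le _ k) of_real0 of_real_hnorm. Qed.

Lemma ler_hnormD x y : hnorm (x + y) <= hnorm x + hnorm y.
Proof.
by rewrite -(@of_real_le _ k) of_realD !of_real_hnorm ler_normD.
Qed.

Lemma hnormZ a x : hnorm (of_real a *: x) = `|a| * hnorm x.
Proof. by rewrite /hnorm normrZ norm_of_real sRe_of_realM. Qed.

Lemma hnorm_opp x : hnorm (- x) = hnorm x.
Proof. by rewrite /hnorm normrN. Qed.

Lemma hnormC x y : hnorm (x - y) = hnorm (y - x).
Proof. by rewrite -hnorm_opp opprB. Qed.

Lemma hnorm0 : hnorm (0 : H) = 0.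
Proof. by rewrite /hnorm normr0 -(@of_real0 _ k) of_realK. Qed.

Lemma hnorm_le0 x : hnorm x <= 0 -> x = 0.
Proof.
by rewrite -(@of_real_le _ k) of_real0 of_real_hnorm normr_le0 => /eqP.
Qed.

Lemma hnorm_sqr_le0 x : hnorm x ^+ 2 <= 0 -> x = 0.
Proof.
by move=> h; apply: hnorm_le0; rewrite leNgt; apply: contraL h => x0;
  rewrite -ltNge exprn_gt0.
Qed.

Lemma hnorm_triangle x y w : hnorm (x - w) <= hnorm (x - y) + hnorm (y - w).
Proof. by rewrite -{1}(subrK y x) -addrA ler_hnormD. Qed.

Lemma of_realN1 x : of_real (-1) *: x = - x.
Proof. by rewrite of_realN of_real1 scaleN1r. Qed.

Lemma re_innerNl x y : re_inner (- x) y = - re_inner x y.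
Proof. by rewrite -of_realN1 re_innerZl mulN1r. Qed.

Lemma re_innerBl x y w : re_inner (x - y) w = re_inner x w - re_inner y w.
Proof. by rewrite re_innerDl re_innerNl. Qed.

Lemma re_innerDr x y w : re_inner w (x + y) = re_inner w x + re_inner w y.
Proof. by rewrite !(re_innerC w) re_innerDl. Qed.

Lemma re_innerNr x y : re_inner y (- x) = - re_inner y x.
Proof. by rewrite !(re_innerC y) re_innerNl. Qed.

Lemma re_innerBr x y w : re_inner w (x - y) = re_inner w x - re_inner w y.
Proof. by rewrite re_innerDr re_innerNr. Qed.

Lemma re_innerZr a x y : re_inner y (of_real a *: x) = a * re_inner y x.
Proof. by rewrite !(re_innerC y) re_innerZl. Qed.

Lemma re_inner0l x : re_inner 0 x = 0.
Proof. by rewrite -(subrr x) re_innerBl subrr. Qed.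

Lemma re_inner0r x : re_inner x 0 = 0.
Proof. by rewrite re_innerC re_inner0l. Qed.

Lemma Cauchy_Schwarz_sqr x y : re_inner x y ^+ 2 <= hnorm x ^+ 2 * hnorm y ^+ 2.
Proof.
apply: discriminant_le => [|t]; first exact: sqr_ge0.
have := sqr_ge0 (hnorm (x + of_real t *: y)).
rewrite -[leRHS]re_inner_hnorm !(re_innerDl, re_innerDr, re_innerZl, re_innerZr).
by rewrite (re_innerC y x) !re_inner_hnorm; lra.
Qed.

Lemma Cauchy_Schwarz x y : `|re_inner x y| <= hnorm x * hnorm y.
Proof.
have xy : 0 <= hnorm x * hnorm y by rewrite mulr_ge0 ?hnorm_ge0.
rewrite -(ger0_norm xy) -ler_sqr ?nnegrE // !real_normK ?num_real // exprMn.
exact: Cauchy_Schwarz_sqr.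
Qed.

Lemma hnormD_sqr_le x y : hnorm (x + y) ^+ 2 <= 2 * hnorm x ^+ 2 + 2 * hnorm y ^+ 2.
Proof.
have := sqr_ge0 (hnorm (x - y)).
rewrite -!re_inner_hnorm !(re_innerDl, re_innerDr, re_innerNl, re_innerNr).
by rewrite (re_innerC y x); lra.
Qed.

End RealStructure.

(** * Topology and boundedness in terms of the real norm *)

Section Topology.
Context {R : realType} {k : scalar_kind} {H : hilbertType R k}.
Implicit Types (x y : H) (S : set H).

Lemma nbhs_hnormP x S :
  nbhs x S <-> exists2 e : R, 0 < e & forall y, hnorm (y - x) < e -> S y.
Proof.
split=> [/nbhs_normP[e /= e0 eS]|[e e0 eS]].
- exists (sRe e); first by rewrite -(@of_real_lt _ k) of_real0 sReK ?ltW.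
  move=> y; rewrite -(@of_real_lt _ k) sReK ?ltW // of_real_hnorm => ye.
  by apply: eS; rewrite /= distrC.
- apply/nbhs_normP; exists (of_real e); first by rewrite /= -of_real0 of_real_lt.
  move=> y /=; rewrite distrC -of_real_hnorm of_real_lt; exact: eS.
Qed.

Lemma cvg_hnormP (T : Type) (F : set_system T) (FF : Filter F) (f : T -> H) x :
  f t @[t --> F] --> x <-> forall e : R, 0 < e -> \near F, hnorm (f F - x) < e.
Proof.
split=> [fx e e0|h].
  by apply: (fx (fun y => hnorm (y - x) < e)); apply/nbhs_hnormP; exists e.
move=> S /nbhs_hnormP[e e0 eS]; apply: filterS (h _ e0) => t; exact: eS.
Qed.

Lemma closed_hnormP S x : closed S ->
  (forall e : R, 0 < e -> exists2 y, S y & hnorm (y - x) < e) -> S x.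
Proof.
move=> cS h; apply: cS => A /nbhs_hnormP[e e0 eA].
by have [y Sy ye] := h _ e0; exists y; split => //; apply: eA.
Qed.

(** Since the rate survives in the limit, it can be fed into the next estimate
    without choosing indices. *)
Lemma cauchy_rate (a : nat -> H) (c : R) :
  (forall n m, (n <= m)%N -> hnorm (a n - a m) ^+ 2 <= c / n.+1%:R) ->
  exists x, forall n, hnorm (a n - x) ^+ 2 <= c / n.+1%:R.
Proof.
move=> ha.
have c0 : 0 <= c.
  by have := ha 0%N 0%N (leqnn _); rewrite divr1; apply: le_trans; rewrite sqr_ge0.
have small (e : R) : 0 < e -> exists n, c / n.+1%:R < e ^+ 2.
  move=> e0; exists (Num.truncn (c / e ^+ 2)).
  rewrite ltr_pdivrMr // mulrC -ltr_pdivrMr ?exprn_gt0 //; exact: truncnS_gt.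
have : cvg (a @ \oo).
  apply: cauchy_cvg; apply: cauchy_exP => e e0.
  have e'0 : 0 < sRe e by rewrite -(@of_real_lt _ k) of_real0 sReK ?ltW.
  have [n ne] := small _ e'0.
  exists (a n); exists n => // m /= nm.
  rewrite -ball_normE /= -of_real_hnorm -(sReK (ltW e0)) of_real_lt.
  rewrite -ltr_sqr ?nnegrE ?hnorm_ge0 ?(ltW e'0) //.
  exact: le_lt_trans (ha _ _ nm) ne.
move=> /cvg_ex[x /cvg_hnormP ax]; exists x => n.
have cn : 0 <= c / n.+1%:R by rewrite divr_ge0.
rewrite -[leRHS]sqr_sqrtr // ler_sqr ?nnegrE ?hnorm_ge0 ?sqrtr_ge0 //.
apply/ler_addgt0Pr => e e0.
have [N _ Nm] := ax e e0.
pose m := maxn n N.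
apply: le_trans (hnorm_triangle _ (a m) _) _; apply: lerD; last first.
  by apply/ltW/Nm; rewrite /= leq_maxr.
rewrite -ler_sqr ?nnegrE ?hnorm_ge0 ?sqrtr_ge0 // sqr_sqrtr //.
by apply: ha; rewrite leq_maxl.
Qed.

End Topology.

Definition bounded_operator {R : realType} {k : scalar_kind}
    {H G : hilbertType R k} (T : H -> G) (c : R) :=
  forall x, hnorm (T x) <= c * hnorm x.

Section BoundedOperators.
Context {R : realType} {k : scalar_kind} {H G : hilbertType R k}.

Lemma continuous_bounded_operator (T : {linear H -> G}) :
  continuous T -> exists2 c : R, 0 < c & bounded_operator T c.
Proof.
move=> cT; have : nbhs (0 : H) (fun x => hnorm (T x - T 0) < (1 : R)).
  by apply: (cT 0 (fun y => hnorm (y - T 0) < 1)); apply/nbhs_hnormP; exists 1.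
move=> /nbhs_hnormP[e e0 eT]; exists (2 / e); first by rewrite divr_gt0.
move=> x; have [x0|] := eqVneq (hnorm x) 0.
  have -> : x = 0 by apply: hnorm_le0; rewrite x0.
  by rewrite linear0 !hnorm0 mulr0.
move=> xn0; have x0 : 0 < hnorm x by rewrite lt_neqAle eq_sym xn0 hnorm_ge0.
pose s := e / (2 * hnorm x).
have s0 : 0 < s by rewrite divr_gt0 // mulr_gt0.
have := eT (of_real s *: x).
rewrite linear0 !subr0 hnormZ linearZ hnormZ gtr0_norm //.
have -> : s * hnorm x = e / 2 by rewrite /s; field.
rewrite ltr_pdivrMr // ltr_pMr // ltr1n => /(_ isT)/ltW.
rewrite -ler_pdivlMl // => /le_trans; apply.
by rewrite le_eqVlt; apply/orP; left; apply/eqP; rewrite /s; field; rewrite xn0 gt_eqF.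
Qed.

End BoundedOperators.

(** * Uniform boundedness on a closed subspace *)

(** Real scalars suffice, for complex spaces too: only real parts of inner
    products are ever compared. *)
Definition real_subspace {R : realType} {k : scalar_kind}
    {X : lmodType (Defs.scalar R k)} (S : set X) :=
  [/\ S 0, forall x y, S x -> S y -> S (x + y)
    & forall (a : R) x, S x -> S (of_real a *: x)].

Lemma real_subspaceB {R : realType} {k : scalar_kind}
    {X : lmodType (Defs.scalar R k)} (S : set X) x y :
  real_subspace S -> S x -> S y -> S (x - y).
Proof.
move=> [_ SD SZ] Sx Sy; apply: SD => //.
by have := SZ (-1) _ Sy; rewrite of_realN of_real1 scaleN1r.
Qed.

(** The Banach-Steinhaus theorem for seminorms, on a subspace because the
    range of [[A B]], to which it is applied, is complete only through being closed.
    If no uniform bound exists, then every ball centred in [S] contains a smaller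
    one on which some seminorm of the family exceeds a prescribed number.  Iterating
    gives nested balls, and the family is unbounded at their common point. *)
Lemma uniform_boundedness {R : realType} {k : scalar_kind}
    {H : hilbertType R k} (S : set H) (I : Type) (p : I -> H -> R) :
  closed S -> real_subspace S ->
  (forall i x y, p i (x + y) <= p i x + p i y) ->
  (forall i a x, p i (of_real a *: x) = `|a| * p i x) ->
  (forall i, exists2 c : R, 0 < c & forall x, p i x <= c * hnorm x) ->
  (forall x, S x -> exists M : R, forall i, p i x <= M) ->
  exists2 M : R, 0 < M & forall i x, S x -> p i x <= M * hnorm x.
Proof.
move=> cS subS pD pZ pc pS; apply: contrapT => unbounded.
have pN i x : p i (- x) = p i x.
  by rewrite -of_realN1 pZ normrN1 mul1r.
have [S0 SD SZ] := subS.
(* a ball is a pair (centre, radius) *)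
pose good (n : nat) (b b' : H * R) := S b'.1 /\ [/\ 0 < b'.2, b'.2 <= n.+1%:R^-1,
  hnorm (b'.1 - b.1) + b'.2 <= b.2 &
  exists i, forall y, hnorm (y - b'.1) <= b'.2 -> n%:R <= p i y].
have shrink (n : nat) (b : H * R) : S b.1 -> 0 < b.2 -> exists b', good n b b'.
  case: b => x r /= Sx r0.
  pose M : R := (n.+1%:R *+ 2) / r.
  have M0 : 0 < M by rewrite divr_gt0 ?pmulrn_lgt0.
  have [i [h Sh ph]] : exists i, exists2 h, S h & M * hnorm h < p i h.
    apply: contrapT => no; apply: unbounded; exists M => // i y Sy.
    by rewrite leNgt; apply/negP => yM; apply: no; exists i, y.
  have [c c0 pic] := pc i.
  have h0 : 0 < hnorm h.
    rewrite lt_neqAle hnorm_ge0 andbT eq_sym; apply/eqP => h0.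
    by move: (pic h); rewrite leNgt h0 mulr0 (le_lt_trans _ ph) // h0 mulr0.
  pose g := of_real (r / 2 / hnorm h) *: h.
  have gn : hnorm g = r / 2.
    rewrite hnormZ ger0_norm; last by rewrite !divr_ge0 // ltW.
    by field; rewrite gt_eqF.
  have Sg : S g by exact: SZ.
  have pg : n.+1%:R < p i g.
    rewrite pZ ger0_norm; last by rewrite !divr_ge0 // ltW.
    have -> : n.+1%:R = (r / 2 / hnorm h) * (M * hnorm h).
      by rewrite /M mulr2n; field; rewrite !gt_eqF.
    by rewrite ltr_pM2l // !divr_gt0.
  (* p_i exceeds n + 1 at one of the points x + g and x - g, because
     2 p_i(g) <= p_i(x + g) + p_i(x - g) *)
  have [y [Sy yx py]] : exists y, [/\ S y, hnorm (y - x) = r / 2 & n.+1%:R < p i y].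
    have g2 : p i (of_real 2 *: g) <= p i (x + g) + p i (x - g).
      rewrite -(pN _ (x - g)).
      have -> : of_real 2 *: g = x + g + - (x - g).
        rewrite opprB [RHS]addrC addrA subrK.
        by rewrite of_realD of_real1 scalerDl scale1r.
      exact: pD.
    rewrite pZ ger0_norm // in g2.
    have [lt|ge] := ltP n.+1%:R (p i (x + g)).
      by exists (x + g); split; [exact: SD| rewrite addrAC subrr add0r|].
    exists (x - g); split; [exact: real_subspaceB| |lra].
    by rewrite addrAC subrr add0r; apply: etrans gn; exact: hnorm_opp.
  (* the bound c^-1 lets p_i drop by at most 1 on the new ball *)
  pose r' := Num.min (r / 2) (Num.min n.+1%:R^-1 c^-1).
  have r'0 : 0 < r' by rewrite !lt_min divr_gt0 // !invr_gt0 c0 ltr0Sn.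
  have [r'1 [r'2 r'3]] : r' <= r / 2 /\ r' <= n.+1%:R^-1 /\ r' <= c^-1.
    have : r' <= r' by [].
    by rewrite {2}/r' !le_min => /andP[-> /andP[-> ->]].
  exists (y, r'); split => //=; split => //.
    by rewrite yx; lra.
  exists i => w wy.
  have : p i y <= p i w + p i (y - w) by rewrite -{1}(subrK w y) addrC pD.
  have : p i (y - w) <= 1.
    apply: le_trans (pic _) _; rewrite hnormC.
    by rewrite mulrC -ler_pdivlMr // div1r (le_trans wy).
  move: py; rewrite -natr1; lra.
have /choice[f fP] (nb : nat * (H * R)) :
    exists b', S nb.2.1 -> 0 < nb.2.2 -> good nb.1 nb.2 b'.
  have [[Sb b0]|no] := pselect (S nb.2.1 /\ 0 < nb.2.2).
    by have [b' gb'] := shrink nb.1 _ Sb b0; exists b'.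
  by exists nb.2 => Sb b0; case: no.
pose b := fix b n := if n is m.+1 then f (m, b m) else ((0, 1) : H * R).
have bSr n : S (b n).1 /\ 0 < (b n).2.
  elim: n => [|n [Sb b0]] /=; first by split.
  by have [Sb' [b'0 _ _ _]] := fP (n, b n) Sb b0; split.
have bP n : good n (b n) (b n.+1) by have [? ?] := bSr n; exact: (fP (n, b n)).
have nested n m : (n <= m)%N -> hnorm ((b m).1 - (b n).1) + (b m).2 <= (b n).2.
  move=> /subnK <-; elim: (m - n)%N => [|j IH]; first by rewrite subrr hnorm0 add0r.
  rewrite addSn; have [_ [_ _ h _]] := bP (j + n)%N.
  apply: le_trans IH; have := hnorm_triangle (b (j + n).+1).1 (b (j + n)%N).1 (b n).1.
  by move: h; rewrite -/(b (j + n).+1); lra.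
have [y yP] : exists y, forall n, hnorm ((b n.+1).1 - y) ^+ 2 <= 1 / n.+1%:R.
  apply: (@cauchy_rate _ _ _ (fun n => (b n.+1).1)) => n m nm.
  have [_ [r0 r1 _ _]] := bP n.
  have := nested n.+1 m.+1 nm; have [_ rm0] := bSr m.+1 => hr.
  have hle : hnorm ((b n.+1).1 - (b m.+1).1) <= n.+1%:R^-1.
    by rewrite hnormC; apply: le_trans r1; apply: le_trans hr; rewrite lerDl ltW.
  rewrite expr2 div1r -[leRHS]mulr1 ler_pM ?hnorm_ge0 //.
  by rewrite (le_trans hle) // invf_le1 // ler1n.
have Sy : S y.
  apply: closed_hnormP => // e e0.
  exists (b (Num.truncn (e ^- 2)).+1).1.
    by have [] := bSr (Num.truncn (e ^- 2)).+1.
  rewrite -ltr_sqr ?nnegrE ?hnorm_ge0 ?(ltW e0) //; apply: le_lt_trans (yP _) _.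
  by rewrite div1r -[ltRHS]invrK ltf_pV2 ?posrE ?invr_gt0 ?exprn_gt0 // truncnS_gt.
have yb n : hnorm (y - (b n).1) <= (b n).2.
  apply/ler_addgt0Pr => e e0.
  pose m := maxn n (Num.truncn (e ^- 2)).
  have nm : (n <= m.+1)%N by rewrite ltnW // ltnS leq_maxl.
  have := hnorm_triangle y (b m.+1).1 (b n).1.
  have := nested _ _ nm; have [_ bm0] := bSr m.+1.
  have : hnorm (y - (b m.+1).1) < e.
    rewrite hnormC -ltr_sqr ?nnegrE ?hnorm_ge0 ?(ltW e0) //.
    apply: le_lt_trans (yP _) _.
    rewrite div1r -[ltRHS]invrK ltf_pV2 ?posrE ?invr_gt0 ?exprn_gt0 //.
    by apply: lt_le_trans (truncnS_gt _) _; rewrite ler_nat ltnS leq_maxr.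
  lra.
have [M pM] := pS _ Sy.
have [_ [_ _ _ [i pi]]] := bP (Num.truncn M).+1.
have := pM i; rewrite leNgt => /negP; apply.
by apply: lt_le_trans (truncnS_gt _) (pi _ _); exact: yb.
Qed.

(** * Riesz representation for a semi-inner product *)

Section Riesz.
Context {R : realType} {k : scalar_kind} {X : lmodType (Defs.scalar R k)}.
Variables (S : set X) (q : X -> X -> R) (l : X -> R).
Hypothesis subS : real_subspace S.
Hypothesis qD : forall x y w, q (x + y) w = q x w + q y w.
Hypothesis qZ : forall a x y, q (of_real a *: x) y = a * q x y.
Hypothesis qC : forall x y, q x y = q y x.
Hypothesis q_ge0 : forall x, S x -> 0 <= q x x.
Hypothesis lD : forall x y, l (x + y) = l x + l y.
Hypothesis lZ : forall a x, l (of_real a *: x) = a * l x.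
Hypothesis complete : forall a : nat -> X, (forall n, S (a n)) ->
  (forall n m, (n <= m)%N -> q (a n - a m) (a n - a m) <= 1 / n.+1%:R) ->
  exists2 x, S x & exists c, forall n, q (a n - x) (a n - x) <= c / n.+1%:R.
Hypothesis bounded : exists M, forall x, S x -> l x ^+ 2 <= M * q x x.

Let qDr x y w : q w (x + y) = q w x + q w y.
Proof. by rewrite !(qC w) qD. Qed.

Let qZr a x y : q y (of_real a *: x) = a * q y x.
Proof. by rewrite !(qC y) qZ. Qed.

Let q_opp x y : q (- x) y = - q x y.
Proof. by rewrite -scaleN1r -of_real1 -of_realN qZ mulN1r. Qed.

Let q_oppr x y : q y (- x) = - q y x.
Proof. by rewrite !(qC y) q_opp. Qed.

Let qE := (qD, qDr, qZ, qZr, q_opp, q_oppr).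

Lemma semi_inner_Cauchy_Schwarz x y : S x -> S y ->
  q x y ^+ 2 <= q x x * q y y.
Proof.
have [_ SD SZ] := subS => Sx Sy.
apply: discriminant_le => [|t]; first exact: q_ge0.
have := q_ge0 (SD _ _ Sx (SZ t _ Sy)); rewrite !qE (qC y x); lra.
Qed.

(** The representing vector minimises [J x = q x x + 2 * l x] on [S].  By the
    parallelogram identity a minimising sequence is Cauchy for [q], and near-minimality
    along each line [x + t h] bounds [q x h + l h] by a discriminant argument.  The
    completeness hypothesis is phrased with sequences and [q] only, so that it can
    be checked on a graph that carries no topology of its own. *)
Theorem Riesz_representation : exists2 x, S x & forall h, S h -> q x h + l h = 0.
Proof.
have [S0 SD SZ] := subS; have [M lM] := bounded.
pose J x := q x x + 2 * l x.
have J_lb x : S x -> - `|M| <= J x.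
  move=> Sx; rewrite /J; have qx := q_ge0 Sx; have lx := lM _ Sx.
  have Mn : M <= `|M| by exact: ler_norm.
  have M0 := normr_ge0 M.
  have {}lx : l x ^+ 2 <= `|M| * q x x by apply: le_trans lx _; rewrite ler_wpM2r.
  exact: quadratic_lower_bound.
pose E := [set J x | x in S].
have infE : has_inf E.
  by split; [exists (J 0), 0 | exists (- `|M|) => _ [x Sx <-]; exact: J_lb].
(* 4^-1 absorbs the factor of the parallelogram identity *)
pose eps n : R := 4^-1 / n.+1%:R.
have eps0 n : 0 < eps n by rewrite divr_gt0 ?invr_gt0 ?ltr0n.
have /choice[a aP] n : exists x, S x /\ J x < inf E + eps n.
  by have [_ [x Sx <-] lt] := inf_adherent (eps0 n) infE; exists x.
have Sa n : S (a n) by have [] := aP n.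
have infJ x : S x -> inf E <= J x by move=> Sx; apply: ge_inf; [exact: infE.2|exists x].
have cauchy n m : (n <= m)%N -> q (a n - a m) (a n - a m) <= 1 / n.+1%:R.
  move=> nm; have [_ Jn] := aP n; have [_ Jm] := aP m.
  have Jmid := infJ _ (SZ 2^-1 _ (SD _ _ (Sa n) (Sa m))).
  have epsm : eps m <= eps n
    by rewrite /eps ler_pM2l ?invr_gt0 // lef_pV2 ?posrE // ler_nat.
  have -> : 1 / n.+1%:R = 4 * eps n by rewrite /eps mulrA divff ?pnatr_eq0.
  by move: Jn Jm Jmid epsm; rewrite /J !lZ !lD !qE (qC (a m) (a n)); lra.
have [x Sx [c xc]] := complete Sa cauchy.
exists x => // h Sh; apply/eqP; rewrite -sqrf_eq0 eq_le sqr_ge0 andbT.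
apply: (@harmonic_le0 _ _ (2 * (4^-1 + c) * q h h)) => n.
have var : (q (a n) h + l h) ^+ 2 <= eps n * q h h.
  apply: discriminant_le => [|t]; first exact: q_ge0.
  have := infJ _ (SD _ _ (Sa n) (SZ t _ Sh)); have [_] := aP n.
  by rewrite /J !lD !lZ !qE (qC h (a n)); lra.
have dist : q (a n - x) h ^+ 2 <= c / n.+1%:R * q h h.
  apply: le_trans (semi_inner_Cauchy_Schwarz (real_subspaceB subS (Sa n) Sx) Sh) _.
  by rewrite ler_wpM2r // q_ge0.
have -> : 2 * (4^-1 + c) * q h h / n.+1%:R =
    2 * (eps n * q h h) + 2 * (c / n.+1%:R * q h h) by rewrite /eps; ring.
move: var dist; rewrite qD q_opp; set e1 := eps n * _; set e2 := c / _ * _.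
move=> var dist; have := sqr_ge0 ((q (a n) h + l h) + (q (a n) h - q x h)); lra.
Qed.

End Riesz.

(** * Generators of strongly continuous semigroups are closed *)

Section Semigroup.
Context {R : realType} {k : scalar_kind} {H : hilbertType R k}.
Variable S : R -> {linear H -> H}.
Hypothesis semiS : C0_semigroup S.

Lemma near_at_right0 (P : set R) :
  (\forall t \near (0 : R)^'+, P t) <->
  exists2 d : R, 0 < d & forall t, 0 < t -> t < d -> P t.
Proof.
split=> [/nbhs_normP[d /= d0 dP]|[d d0 dP]].
- exists d => // t t0 td; apply: dP => //=.
  by rewrite sub0r normrN gtr0_norm.
- apply/nbhs_normP; exists d => //= t; rewrite /= sub0r normrN => td t0.
  by apply: dP => //; apply: le_lt_trans td; exact: ler_norm.
Qed.

Lemma semigroup_continuous_at0 x (e : R) : 0 < e ->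
  exists2 d : R, 0 < d & forall t, 0 <= t -> t < d -> hnorm (S t x - x) < e.
Proof.
move=> e0; have /cvg_hnormP/(_ _ e0)/near_at_right0[d d0 dP] :=
  semigroup_strong semiS (x := x).
exists d => // t; rewrite le_eqVlt => /orP[/eqP <- _|]; last exact: dP.
by rewrite (semigroup0 semiS) subrr hnorm0.
Qed.

(** Otherwise some operators [S t_n] with [t_n] tending to 0 have norms tending to
    infinity, although each orbit [S t_n x] converges to [x]: this contradicts the
    uniform boundedness principle. *)
Lemma semigroup_locally_bounded : exists2 d : R, 0 < d &
  exists2 M : R, 0 < M & forall t, 0 <= t -> t <= d -> bounded_operator (S t) M.
Proof.
apply: contrapT => unbounded.
have /choice[tx txP] n : exists tx : R * H,
    [/\ 0 <= tx.1, tx.1 <= n.+1%:R^-1 & n.+1%:R * hnorm tx.2 < hnorm (S tx.1 tx.2)].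
  apply: contrapT => no; apply: unbounded.
  exists n.+1%:R^-1; rewrite ?invr_gt0 //; exists n.+1%:R => // t t0 tn x.
  by rewrite leNgt; apply/negP => tx; apply: no; exists (t, x).
have [M M0 MP] : exists2 M : R, 0 < M & forall n x, setT x ->
    hnorm (S (tx n).1 x) <= M * hnorm x.
  apply: (@uniform_boundedness _ _ _ setT) => //.
  - by move=> n x y; rewrite linearD ler_hnormD.
  - by move=> n a x; rewrite linearZ hnormZ.
  - move=> n; have [t0 _ _] := txP n.
    exact: continuous_bounded_operator (semigroup_continuous semiS t0).
  move=> x _; have [d d0 dP] := semigroup_continuous_at0 x ltr01.
  pose N := Num.truncn d^-1.
  exists (\sum_(i < N) hnorm (S (tx i).1 x) + (1 + hnorm x)) => n.
  have s0 : 0 <= \sum_(i < N) hnorm (S (tx i).1 x).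
    by apply: sumr_ge0 => i _; exact: hnorm_ge0.
  have [nN|Nn] := ltnP n N.
    rewrite (bigD1 (Ordinal nN)) //= -addrA lerDl addr_ge0 //.
      by apply: sumr_ge0 => i _; exact: hnorm_ge0.
    by rewrite addr_ge0 // hnorm_ge0.
  have [t0 tn _] := txP n.
  have : hnorm (S (tx n).1 x - x) < 1.
    apply: dP => //; apply: le_lt_trans tn _.
    rewrite -[ltRHS]invrK ltf_pV2 ?posrE ?invr_gt0 //.
    by apply: lt_le_trans (truncnS_gt _) _; rewrite ler_nat ltnS.
  have := ler_hnormD (S (tx n).1 x - x) x; rewrite subrK; lra.
have [_ _] := txP (Num.truncn M); rewrite ltNge => /negP; apply.
apply: le_trans (MP _ _ I) _; rewrite ler_wpM2r ?hnorm_ge0 //.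
exact/ltW/truncnS_gt.
Qed.

(** Convergence of the difference quotient freed of the division by [t], which is
    the form that can be summed over a subdivision of [[0, t]]. *)
Lemma diff_quotient_cvgP x y : diff_quotient S x t @[t --> (0 : R)^'+] --> y <->
  forall e : R, 0 < e -> exists2 d : R, 0 < d & forall t, 0 < t -> t < d ->
    hnorm (S t x - x - of_real t *: y) <= e * t.
Proof.
have quot t : 0 < t ->
    hnorm (diff_quotient S x t - y) = hnorm (S t x - x - of_real t *: y) / t.
  move=> t0; have -> : S t x - x - of_real t *: y =
      of_real t *: (diff_quotient S x t - y).
    rewrite scalerBr /diff_quotient scalerA -of_realM divff ?gt_eqF //.
    by rewrite of_real1 scale1r.
  by rewrite hnormZ gtr0_norm // mulrAC divff ?mul1r // gt_eqF.
split=> [/cvg_hnormP h e e0|h].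
- have /near_at_right0[d d0 dP] := h _ e0; exists d => // t t0 td.
  by have := dP _ t0 td; rewrite quot // ltr_pdivrMr // => /ltW.
- apply/cvg_hnormP => e e0; apply/near_at_right0.
  have [|d d0 dP] := h (e / 2); first by rewrite divr_gt0.
  exists d => // t t0 td; rewrite quot // ltr_pdivrMr //.
  by apply: le_lt_trans (dP _ t0 td) _; rewrite ltr_pM2r //; lra.
Qed.

(** A discrete mean value inequality: [S (n h) x - x] is the sum of the increments
    [S (j h) (S h x - x)], so a bound for the distance of each of them to [h y]
    passes to the sum.  It replaces the integral formula
    [S t x - x = int_0^t S s (A x) ds]. *)
Lemma semigroup_telescope x y (h r : R) (n : nat) : 0 <= h ->
  (forall j : nat, (j < n)%N ->
     hnorm (S (j%:R * h) (S h x - x) - of_real h *: y) <= h * r) ->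
  hnorm (S (n%:R * h) x - x - of_real (n%:R * h) *: y) <= n%:R * h * r.
Proof.
move=> h0; elim: n => [_|n IH hn].
  by rewrite !mul0r (semigroup0 semiS) subrr sub0r of_real0 scale0r hnorm_opp hnorm0.
have := IH (fun j jn => hn j (ltnW jn)); have := hn n (leqnn _).
set u := S _ (S h x - x) - _; set w := S (n%:R * h) x - _ - _ => un wn.
have -> : S (n.+1%:R * h) x - x - of_real (n.+1%:R * h) *: y = u + w.
  rewrite -natr1 mulrDl mul1r (semigroupD semiS) // ?mulr_ge0 //.
  rewrite of_realD scalerDl /u /w linearB.
  rewrite [RHS]addrACA (addrA _ _ (- x)) subrK.
  by rewrite -opprD (addrC (of_real h *: y)).
rewrite -natr1; apply: le_trans (ler_hnormD _ _) _; lra.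
Qed.

End Semigroup.

Section Generator.
Context {R : realType} {k : scalar_kind} {H : hilbertType R k}.
Variables (domA : set H) (A : H -> H).
Hypothesis genA : generates_C0_semigroup domA A.

Lemma generatorD x y : domA x -> domA y ->
  domA (x + y) /\ A (x + y) = A x + A y.
Proof.
have [S [_ defA limA]] := genA => dx dy.
suff h : diff_quotient S (x + y) t @[t --> (0 : R)^'+] --> A x + A y.
  have dxy : domA (x + y) by rewrite defA; apply/cvg_ex; exists (A x + A y).
  split=> //; apply: cvg_unique (limA _ dxy) h; exact: norm_hausdorff.
have -> : diff_quotient S (x + y) = diff_quotient S x \+ diff_quotient S y.
  apply/funext => t; rewrite /diff_quotient /= -[RHS]scalerDr.
  by rewrite (linearD (S t)) opprD addrACA.
by apply: cvgD; exact: limA.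
Qed.

Lemma generatorZ a x : domA x ->
  domA (of_real a *: x) /\ A (of_real a *: x) = of_real a *: A x.
Proof.
have [S [_ defA limA]] := genA => dx.
suff h : diff_quotient S (of_real a *: x) t @[t --> (0 : R)^'+] --> of_real a *: A x.
  have dax : domA (of_real a *: x).
    by rewrite defA; apply/cvg_ex; exists (of_real a *: A x).
  split=> //; apply: cvg_unique (limA _ dax) h; exact: norm_hausdorff.
have -> : diff_quotient S (of_real a *: x) = fun t => of_real a *: diff_quotient S x t.
  apply/funext => t; rewrite /diff_quotient /= linearZ -scalerBr !scalerA.
  by rewrite mulrC.
by apply: cvgZr; exact: limA.
Qed.

Lemma generator_subspace : real_subspace domA.
Proof.
split=> [|x y dx dy|a x dx]; last by have [] := generatorZ a dx.
- have [S [_ defA _]] := genA; rewrite defA; apply/cvg_ex; exists 0.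
  have -> : diff_quotient S 0 = fun=> 0.
    by apply/funext => t; rewrite /diff_quotient linear0 subrr scaler0.
  exact: cvg_cst.
- by have [] := generatorD dx dy.
Qed.

(** Let [x'] approximate [x] while [A x'] approximates [y].  For small [h] the
    increment [S h x' - x'] is close to [h y], and [semigroup_telescope] turns this
    into a bound for [S t x' - x' - t y] by [t] times the sum of two terms: one vanishes
    with the error of approximation, the other is the oscillation of [S s y] on
    [[0, t]].  Letting [x'] tend to [x] at fixed [t] leaves only the oscillation, which vanishes
    with [t]. *)
Lemma generator_closed x y :
  (forall e : R, 0 < e ->
     exists2 x', domA x' & hnorm (x' - x) < e /\ hnorm (A x' - y) < e) ->
  domA x /\ A x = y.
Proof.
have [S [semiS defA limA]] := genA => approx.
suff h : diff_quotient S x t @[t --> (0 : R)^'+] --> y.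
  have dx : domA x by rewrite defA; apply/cvg_ex; exists y.
  split=> //; apply: cvg_unique (limA _ dx) h; exact: norm_hausdorff.
apply/diff_quotient_cvgP => e e0.
have [d d0 [M M0 SM]] := semigroup_locally_bounded semiS.
have [d' d'0 yd'] := semigroup_continuous_at0 semiS y e0.
exists (Num.min d d'); first by rewrite lt_min d0.
move=> t t0; rewrite lt_min => /andP[td td'].
apply/ler_addgt0Pr => e1 e10.
(* C collects the total weight of the error e2 in the estimates below *)
pose C := t * M * 2 + M + 1 + t.
have C0 : 0 < C by rewrite /C !addr_gt0 // !mulr_gt0.
pose e2 := e1 / C.
have e20 : 0 < e2 by rewrite divr_gt0.
have [x' dx' [xx' Axy]] := approx _ e20.
have /diff_quotient_cvgP/(_ _ e20)[d2 d20 d2P] := limA _ dx'.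
pose n := Num.truncn (t / d2).
pose h := t / n.+1%:R.
have h0 : 0 < h by rewrite divr_gt0.
have hd2 : h < d2.
  by rewrite /h ltr_pdivrMr // mulrC -ltr_pdivrMr //; exact: truncnS_gt.
have nh : n.+1%:R * h = t by rewrite /h mulrCA divff ?mulr1 // pnatr_eq0.
have step : hnorm (S h x' - x' - of_real h *: y) <= h * (2 * e2).
  have := d2P _ h0 hd2 => h1.
  have -> : S h x' - x' - of_real h *: y =
      (S h x' - x' - of_real h *: A x') + of_real h *: (A x' - y).
    by rewrite scalerBr addrA subrK.
  apply: le_trans (ler_hnormD _ _) _; rewrite hnormZ gtr0_norm //.
  have : h * hnorm (A x' - y) <= h * e2 by rewrite ler_wpM2l // ltW.
  lra.
have := @semigroup_telescope _ _ _ _ semiS x' y h (M * (2 * e2) + e) n.+1 (ltW h0).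
rewrite nh => tele.
have {}tele : hnorm (S t x' - x' - of_real t *: y) <= t * (M * (2 * e2) + e).
  apply: tele => j jn.
  have jt : j%:R * h < t by rewrite -nh ltr_pM2r // ltr_nat.
  have j0 : 0 <= j%:R * h by rewrite mulr_ge0 // ltW.
  have -> : S (j%:R * h) (S h x' - x') - of_real h *: y =
      S (j%:R * h) (S h x' - x' - of_real h *: y) +
      of_real h *: (S (j%:R * h) y - y).
    rewrite [X in _ = X + _]linearB (linearZ_LR (S _)) /= scalerBr addrA.
    by congr (_ - _); exact/esym/subrK.
  apply: le_trans (ler_hnormD _ _) _; rewrite hnormZ gtr0_norm // mulrDr.
  apply: lerD.
    apply: le_trans (SM _ j0 (ltW (lt_trans jt td)) _) _.
    by rewrite [leRHS]mulrCA ler_wpM2l // ltW.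
  by rewrite ler_wpM2l ?ltW // yd' // (lt_trans jt).
have -> : S t x - x - of_real t *: y =
    (S t x' - x' - of_real t *: y) + ((x' - x) - S t (x' - x)).
  rewrite linearB opprB (addrC (x' - x)) [RHS]addrC [RHS]addrACA.
  by rewrite (addrA _ (S t x')) subrK !addrA subrK.
apply: le_trans (ler_hnormD _ _) _.
have : hnorm ((x' - x) - S t (x' - x)) <= e2 + M * e2.
  apply: le_trans (ler_hnormD _ _) _; rewrite hnorm_opp; apply: lerD; first exact: ltW.
  apply: le_trans (SM _ (ltW t0) (ltW td) _) _.
  by rewrite ler_wpM2l // ltW.
have e1E : e1 = e2 * C by rewrite /e2 divfK // gt_eqF.
have te2 : 0 < t * e2 by rewrite mulr_gt0.
rewrite e1E /C; lra.
Qed.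

End Generator.

(** * Multipliers for quadratic programs with closed range *)

(** With [yn], [ym] and [t] the squared norms and the inner product of two vectors
    [y] and [y'], the left-hand side is [a] times
    [<b y' - a y, y - y'> + |y - y'|^2].  The hypothesis that [|a y|] and [|b y'|]
    stay bounded controls the inner product of [y] and [y'] by [V / (a b)]. *)
Lemma penalty_difference_le (R : realType) (V a b t yn ym : R) :
  a <= b -> 1 <= a -> 0 <= ym -> 0 <= yn ->
  0 <= a * (a * yn - b * t) - b * (a * t - b * ym) ->
  ym * b ^+ 2 <= V -> yn * a ^+ 2 <= V ->
  (- a * (yn - t) - - b * (t - ym) + (yn - t - (t - ym))) * a <= 2 * V.
Proof.
move=> ab a1 ym0 yn0 sq Vm Vn.
have abt : b * a * t <= V by lra.
have h1 : 0 <= (a - 1) * yn by rewrite mulr_ge0 // subr_ge0.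
have h2 : 0 <= (b - 1) * ym by rewrite mulr_ge0 // subr_ge0 (le_trans a1).
have a0 : 0 < a by lra.
apply: (@le_trans _ _ ((a + b - 2) * t * a)).
  by rewrite ler_pM2r //; lra.
have [t0|t0] := leP t 0.
- have : (a + b - 2) * (- t) * a >= 0.
    by rewrite !mulr_ge0 ?(ltW a0) ?oppr_ge0 //; lra.
  have : 0 <= yn * a ^+ 2 by rewrite mulr_ge0 ?sqr_ge0.
  lra.
- have : (a + b - 2) * (t * a) <= 2 * b * (t * a).
    by rewrite ler_pM2r ?mulr_gt0 //; lra.
  lra.
Qed.

(** A triple in [G] stands for [(x, u, A x + B u)]: closedness of [G] expresses that
    [A] is closed, closedness of its third components that [[A B]] has closed range.
    The cost is [c p p + 2 * l p] and the constraint is [p.2 = 0]; the form [c] is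
    coercive on [G] once the square of the constraint is added to it. *)
Section Multiplier.
Context {R : realType} {k : scalar_kind} {H U : hilbertType R k}.
Local Notation X := (H * U * H)%type.
Implicit Types (p h : X).

(** The product type carries the supremum norm; this is the square of the Hilbert
    norm of the direct sum. *)
Definition sqr_norm (p : X) : R :=
  hnorm p.1.1 ^+ 2 + hnorm p.1.2 ^+ 2 + hnorm p.2 ^+ 2.

Variables (G : set X) (c : X -> X -> R) (l : X -> R) (L M D : R).
Hypothesis subG : real_subspace G.
Hypothesis closedG : forall p,
  (forall e : R, 0 < e -> exists2 p', G p' & sqr_norm (p' - p) < e) -> G p.
Hypothesis closed_ran : closed [set p.2 | p in G].
Hypothesis cD : forall p p' h, c (p + p') h = c p h + c p' h.
Hypothesis cZ : forall a p h, c (of_real a *: p) h = a * c p h.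
Hypothesis cC : forall p h, c p h = c h p.
Hypothesis lD : forall p p', l (p + p') = l p + l p'.
Hypothesis lZ : forall a p, l (of_real a *: p) = a * l p.
Hypotheses (D0 : 0 < D) (L0 : 0 < L) (M0 : 0 < M).
Hypothesis c_ge0 : forall p, 0 <= c p p.
Hypothesis c_le : forall p, c p p <= D * sqr_norm p.
Hypothesis l_le : forall p, l p ^+ 2 <= M * sqr_norm p.
Hypothesis coerc : forall p, G p -> sqr_norm p <= L * (c p p + hnorm p.2 ^+ 2).

Lemma sqr_norm_ge0 p : 0 <= sqr_norm p.
Proof. by rewrite /sqr_norm !addr_ge0 // sqr_ge0. Qed.

Let cN p h : c (- p) h = - c p h.
Proof. by rewrite -scaleN1r -of_real1 -of_realN cZ mulN1r. Qed.

Lemma sqr_norm_complete (a : nat -> X) (r : R) : (forall n, G (a n)) ->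
  (forall n m, (n <= m)%N -> sqr_norm (a n - a m) <= r / n.+1%:R) ->
  exists2 p, G p & forall n, sqr_norm (a n - p) <= 3 * r / n.+1%:R.
Proof.
move=> Ga cauchy.
have comp (E : hilbertType R k) (f : X -> E) :
    (forall p p', f (p - p') = f p - f p') ->
    (forall p, hnorm (f p) ^+ 2 <= sqr_norm p) ->
    exists x, forall n, hnorm (f (a n) - x) ^+ 2 <= r / n.+1%:R.
  move=> fB fle; apply: cauchy_rate => n m nm.
  by rewrite -fB; apply: le_trans (fle _) _; exact: cauchy.
have [||x xP] := @comp H (fun p => p.1.1) => //.
  by move=> p; rewrite /sqr_norm -addrA lerDl addr_ge0 // sqr_ge0.
have [||u uP] := @comp U (fun p => p.1.2) => //.
  by move=> p; rewrite /sqr_norm -addrA addrCA lerDl addr_ge0 // sqr_ge0.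
have [||y yP] := @comp H (fun p => p.2) => //.
  by move=> p; rewrite /sqr_norm lerDr addr_ge0 // sqr_ge0.
have lim n : sqr_norm (a n - (x, u, y)) <= 3 * r / n.+1%:R.
  rewrite /sqr_norm -mulrA; have := xP n; have := uP n; have := yP n.
  by move=> /=; set s := r / _; lra.
exists (x, u, y) => //; apply: closedG => e e0.
exists (a (Num.truncn (3 * r / e))) => //; apply: le_lt_trans (lim _) _.
by rewrite ltr_pdivrMr // (mulrC e) -ltr_pdivrMr //; exact: truncnS_gt.
Qed.

Lemma penalised_minimiser (n : nat) : exists2 p, G p &
  forall h, G h -> c p h + n.+1%:R * re_inner p.2 h.2 + l h = 0.
Proof.
pose q p h := c p h + n.+1%:R * re_inner p.2 h.2.
have coerq p : G p -> sqr_norm p <= L * q p p.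
  move=> Gp; apply: le_trans (coerc Gp) _; rewrite ler_pM2l // lerD2l.
  by rewrite /q re_inner_hnorm ler_peMl ?sqr_ge0 // ler1n.
apply: (@Riesz_representation _ _ _ G q l) => //.
- by move=> p p' h; rewrite /q cD re_innerDl; ring.
- by move=> a p h; rewrite /q cZ re_innerZl; ring.
- by move=> p h; rewrite /q cC re_innerC.
- by move=> p _; rewrite /q re_inner_hnorm addr_ge0 // mulr_ge0 // sqr_ge0.
- move=> a Ga cauchy.
  have [m k' mk'|p Gp pP] := @sqr_norm_complete a L Ga.
    apply: le_trans (coerq _ (real_subspaceB subG (Ga _) (Ga _))) _.
    by rewrite ler_pM2l // -div1r cauchy.
  exists p => //; exists ((D + n.+1%:R) * (3 * L)) => m.
  apply: (@le_trans _ _ ((D + n.+1%:R) * sqr_norm (a m - p))).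
    rewrite /q re_inner_hnorm mulrDl lerD ?c_le // ler_wpM2l //.
    by rewrite /sqr_norm lerDr addr_ge0 // sqr_ge0.
  by rewrite -mulrA ler_wpM2l ?addr_ge0 // ltW.
- exists (M * L) => p Gp; apply: le_trans (l_le _) _.
  by rewrite -mulrA ler_pM2l // coerq.
Qed.

(** Closed range theorem: the adjoint of the projection of [G] to its third component
    is bounded below on the range of that projection.  Indeed the vectors of the range
    on which the adjoint is at most 1 form a family of functionals that is pointwise
    bounded on the range, hence bounded because the range is closed. *)
Lemma range_bounded_below : exists2 W : R, 0 < W & forall p s, G p -> 0 < s ->
  (forall h, G h -> re_inner p.2 h.2 ^+ 2 <= s * sqr_norm h) ->
  hnorm p.2 ^+ 2 <= W * s.
Proof.
(* an index is a vector together with the norm bound by which it is divided *)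
pose I := {ps : X * R | G ps.1 /\ 0 < ps.2 /\
  forall h, G h -> re_inner ps.1.2 h.2 ^+ 2 <= ps.2 ^+ 2 * sqr_norm h}.
pose f (i : I) (y : H) := `|re_inner (sval i).1.2 y| / (sval i).2.
have [G0 GD GZ] := subG.
have [W W0 WP] : exists2 W : R, 0 < W &
    forall i y, [set p.2 | p in G] y -> f i y <= W * hnorm y.
  apply: uniform_boundedness => //.
  - split; first by exists 0.
    + by move=> _ _ [p Gp <-] [p' Gp' <-]; exists (p + p') => //; exact: GD.
    + by move=> a _ [p Gp <-]; exists (of_real a *: p) => //; exact: GZ.
  - move=> i x y; have [_ [s0 _]] := svalP i; rewrite /f re_innerDr -mulrDl.
    by rewrite ler_wpM2r ?ler_normD // invr_ge0 ltW.
  - by move=> i a x; rewrite /f re_innerZr normrM mulrA.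
  - move=> i; have [_ [s0 _]] := svalP i.
    exists ((hnorm (sval i).1.2 + 1) / (sval i).2).
      by rewrite divr_gt0 // ltr_wpDl // hnorm_ge0.
    move=> x; rewrite /f mulrAC ler_wpM2r //; first by rewrite invr_ge0 ltW.
    apply: le_trans (Cauchy_Schwarz _ _) _.
    by rewrite ler_wpM2r ?hnorm_ge0 // lerDl.
  - move=> _ [h Gh <-]; exists (sqr_norm h + 1) => i; have [_ [s0 ps]] := svalP i.
    rewrite /f ler_pdivrMr //; have hN := sqr_norm_ge0 h.
    have r0 : 0 <= (sqr_norm h + 1) * (sval i).2.
      by apply: mulr_ge0; [exact: addr_ge0 | exact: ltW].
    rewrite -ler_sqr ?nnegrE // !real_normK ?num_real //.
    apply: le_trans (ps _ Gh) _; rewrite exprMn mulrC.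
    by rewrite ler_wpM2r ?sqr_ge0 //; nra.
exists (W ^+ 2) => [|p s Gp s0 ps]; first by rewrite exprn_gt0.
have iP : G (p, Num.sqrt s).1 /\ 0 < (p, Num.sqrt s).2 /\
    forall h, G h -> re_inner (p, Num.sqrt s).1.2 h.2 ^+ 2 <=
      (p, Num.sqrt s).2 ^+ 2 * sqr_norm h.
  by rewrite /= sqrtr_gt0 sqr_sqrtr ?ltW.
have := WP (exist _ _ iP) p.2 (ex_intro2 _ _ p Gp erefl).
rewrite /f /= re_inner_hnorm ger0_norm ?sqr_ge0 //.
rewrite ler_pdivrMr ?sqrtr_gt0 // => h.
have {}h : hnorm p.2 <= W * Num.sqrt s.
  have [p0|pn0] := eqVneq (hnorm p.2) 0.
    by rewrite p0 mulr_ge0 ?sqrtr_ge0 // ltW.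
  have pp : 0 < hnorm p.2 by rewrite lt_neqAle eq_sym pn0 hnorm_ge0.
  by rewrite -(ler_pM2r pp) -expr2 (le_trans h) // mulrAC.
rewrite -[s in leRHS](sqr_sqrtr (ltW s0)) -exprMn ler_sqr ?nnegrE ?hnorm_ge0 //.
by rewrite mulr_ge0 ?sqrtr_ge0 // ltW.
Qed.

Let c_sqr_le p h : c p h ^+ 2 <= D ^+ 2 * sqr_norm p * sqr_norm h.
Proof.
apply: (@le_trans _ _ (c p p * c h h)).
  apply: (@semi_inner_Cauchy_Schwarz _ _ _ setT c) => //.
have -> : D ^+ 2 * sqr_norm p * sqr_norm h = (D * sqr_norm p) * (D * sqr_norm h).
  by ring.
by rewrite ler_pM.
Qed.

(** The constraint is relaxed to the penalty [(n + 1) * |p.2|^2].  The minimiser [p n]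
    satisfies the multiplier rule with [w n = - (n + 1) * (p n).2] in place of the
    multiplier.  Coercivity bounds [p n], hence by [range_bounded_below] also [w n],
    so that [(p n).2] tends to 0 like [1 / (n + 1)].  This makes [p n] a Cauchy
    sequence, and [range_bounded_below] applied to the differences [w n - w m] makes
    [w n] one as well.  The limits form the optimum and its multiplier. *)
Theorem Lagrange_multiplier : exists p w, [/\ G p, p.2 = 0 &
  forall h, G h -> re_inner w h.2 = c p h + l h].
Proof.
have /choice[p /all_and2[Gp pP]] n : exists p, G p /\
    forall h, G h -> c p h + n.+1%:R * re_inner p.2 h.2 + l h = 0.
  by have [p Gp pP] := penalised_minimiser n; exists p.
have [W0 W00 W0P] := range_bounded_below.
have [G0 GD GZ] := subG.
pose w n := of_real (- n.+1%:R) *: (p n).2.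
have wP n h : G h -> re_inner (w n) h.2 = c (p n) h + l h.
  by move=> Gh; have := pP n _ Gh; rewrite /w re_innerZl; lra.
have Np n : sqr_norm (p n) <= L ^+ 2 * M.
  have h1 := coerc (Gp n); have := pP n _ (Gp n).
  rewrite re_inner_hnorm => h2; have h3 := l_le (p n).
  have h4 : hnorm (p n).2 ^+ 2 <= n.+1%:R * hnorm (p n).2 ^+ 2.
    by rewrite ler_peMl ?sqr_ge0 // ler1n.
  have h5 : sqr_norm (p n) <= L * - l (p n).
    by apply: le_trans h1 _; rewrite ler_pM2l //; lra.
  have N0 := sqr_norm_ge0 (p n).
  have [->|Nn0] := eqVneq (sqr_norm (p n)) 0.
    by rewrite mulr_ge0 ?sqr_ge0 // ltW.
  have Np0 : 0 < sqr_norm (p n) by rewrite lt_neqAle eq_sym Nn0.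
  rewrite -(ler_pM2r Np0) -expr2 -mulrA.
  apply: (@le_trans _ _ (L ^+ 2 * l (p n) ^+ 2)); last first.
    by rewrite ler_wpM2l ?sqr_ge0.
  by rewrite -exprMn -[leRHS]sqrrN -mulrN ler_sqr ?nnegrE // (le_trans N0).
pose s := 2 * (D ^+ 2 * (L ^+ 2 * M)) + 2 * M.
have s0 : 0 < s by rewrite addr_gt0 // !mulr_gt0 // exprn_gt0.
pose V := W0 * s.
have V0 : 0 < V by rewrite mulr_gt0.
have wV n : hnorm (w n) ^+ 2 <= V.
  apply: (W0P (of_real (- n.+1%:R) *: p n)) => // [|h Gh]; first exact: GZ.
  rewrite [re_inner _ _](wP n _ Gh) /s mulrDl.
  have := c_sqr_le (p n) h; have := l_le h; have := sqr_ge0 (c (p n) h - l h).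
  have : D ^+ 2 * sqr_norm (p n) * sqr_norm h <= D ^+ 2 * (L ^+ 2 * M) * sqr_norm h.
    by rewrite ler_wpM2r ?sqr_norm_ge0 // ler_wpM2l ?sqr_ge0.
  lra.
have y_le n : hnorm (p n).2 ^+ 2 * n.+1%:R ^+ 2 <= V.
  apply: le_trans (wV n); rewrite /w hnormZ normrN ger0_norm // exprMn.
  by rewrite mulrC.
(* the difference of the two multiplier rules, tested with p n - p m *)
have diff n m : (n <= m)%N -> c (p n - p m) (p n - p m) + hnorm (p n - p m).2 ^+ 2 <=
    2 * V / n.+1%:R.
  move=> nm; have Gd := real_subspaceB subG (Gp n) (Gp m).
  have -> : c (p n - p m) (p n - p m) = re_inner (w n - w m) (p n - p m).2.
    by rewrite re_innerBl !wP // cD cN; ring.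
  rewrite ler_pdivlMr // /w /= -re_inner_hnorm.
  have := y_le n; have := y_le m.
  have := sqr_ge0 (hnorm (of_real n.+1%:R *: (p n).2 - of_real m.+1%:R *: (p m).2)).
  have ab : n.+1%:R <= m.+1%:R :> R by rewrite ler_nat.
  have a1 : 1 <= n.+1%:R :> R by rewrite ler1n.
  move: ab a1; rewrite -!re_inner_hnorm.
  rewrite !(re_innerBl, re_innerBr, re_innerZl, re_innerZr).
  rewrite !(re_innerC (p m).2 (p n).2).
  have := re_inner_hnorm (p n).2; have := sqr_ge0 (hnorm (p n).2).
  have := re_inner_hnorm (p m).2; have := sqr_ge0 (hnorm (p m).2).
  move: (n.+1%:R) (m.+1%:R) (re_inner (p n).2 (p n).2) (re_inner (p m).2 (p m).2).
  move: (re_inner (p n).2 (p m).2) => t a b yn ym + -> + -> ym0 yn0.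
  exact: penalty_difference_le.
pose r := L * (2 * V).
have r0 : 0 < r by rewrite !mulr_gt0.
have [n m nm|q Gq qP] := @sqr_norm_complete p r Gp.
  apply: le_trans (coerc (real_subspaceB subG (Gp n) (Gp m))) _.
  by rewrite -mulrA ler_pM2l // diff.
have [u uP] : exists u, forall n,
    hnorm (w n - u) ^+ 2 <= (W0 * (D ^+ 2 * r)) / n.+1%:R.
  apply: cauchy_rate => n m nm.
  rewrite -mulrA; pose d := of_real (- n.+1%:R) *: p n - of_real (- m.+1%:R) *: p m.
  apply: (W0P d); first by apply: real_subspaceB => //; exact: GZ.
    by rewrite divr_gt0 // mulr_gt0 // exprn_gt0.
  move=> h Gh; have -> : re_inner d.2 h.2 = c (p n - p m) h.
    by rewrite [LHS]re_innerBl !wP // cD cN; ring.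
  apply: le_trans (c_sqr_le _ _) _; rewrite ler_wpM2r ?sqr_norm_ge0 //.
  rewrite -mulrA ler_wpM2l ?sqr_ge0 //.
  apply: le_trans (coerc (real_subspaceB subG (Gp n) (Gp m))) _.
  by rewrite -mulrA ler_pM2l // diff.
exists q, u; split => //.
- apply: hnorm_sqr_le0.
  apply: (@harmonic_le0 _ _ (2 * V + 2 * (3 * r))) => n.
  have := hnormD_sqr_le (p n).2 (q.2 - (p n).2); rewrite addrC subrK => h.
  apply: le_trans h _; rewrite [leRHS]mulrDl; apply: lerD.
    rewrite -mulrA ler_pM2l // ler_pdivlMr //; apply: le_trans (y_le n).
    by rewrite ler_wpM2l ?sqr_ge0 // expr2 ler_peMl // ler1n.
  rewrite -mulrA ler_pM2l // hnormC; apply: le_trans (qP n).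
  by rewrite /sqr_norm lerDr addr_ge0 // sqr_ge0.
- move=> h Gh; apply/eqP; rewrite -subr_eq0 -sqrf_eq0 eq_le sqr_ge0 andbT.
  pose e := 2 * (W0 * (D ^+ 2 * r)) * hnorm h.2 ^+ 2 + 2 * D ^+ 2 * (3 * r) * sqr_norm h.
  apply: (@harmonic_le0 _ _ e) => n.
  have -> : re_inner u h.2 - (c q h + l h) =
      c (p n - q) h - re_inner (w n - u) h.2.
    by rewrite re_innerBl wP // cD cN; ring.
  apply: (@le_trans _ _ (2 * re_inner (w n - u) h.2 ^+ 2 + 2 * c (p n - q) h ^+ 2)).
    by have := sqr_ge0 (c (p n - q) h + re_inner (w n - u) h.2); lra.
  have -> : e / n.+1%:R = 2 * (W0 * (D ^+ 2 * r) / n.+1%:R * hnorm h.2 ^+ 2) +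
      2 * (D ^+ 2 * (3 * r / n.+1%:R) * sqr_norm h) by rewrite /e; ring.
  apply: lerD; rewrite ler_pM2l //.
    apply: le_trans (Cauchy_Schwarz_sqr _ _) _.
    by rewrite ler_wpM2r ?sqr_ge0.
  apply: le_trans (c_sqr_le _ _) _.
  by rewrite ler_wpM2r ?sqr_norm_ge0 // ler_wpM2l ?sqr_ge0.
Qed.

End Multiplier.

(** * Derivative of a quadratic storage function *)

Section QuadraticStorage.
Context {R : realType} {k : scalar_kind} {H : hilbertType R k}.
Variables (P : {linear H -> H}) (pn : R).
Hypotheses (pn0 : 0 < pn) (P_bounded : bounded_operator P pn).
Hypothesis P_self_adjoint : self_adjoint P.

Definition storage_derivative (gamma : R) (w x h : H) : R :=
  2 * gamma * re_inner (P x) h + 2 * re_inner w h.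

Lemma storage_derivativeP gamma w : 0 < gamma ->
  C1_with_derivative (quadratic_storage (fun x => of_real gamma *: P x) w)
    (storage_derivative gamma w).
Proof.
move=> g0; have gp : 0 < gamma * pn by rewrite mulr_gt0.
have Pxy x y : `|re_inner (P x) y| <= pn * hnorm x * hnorm y.
  by apply: le_trans (Cauchy_Schwarz _ _) _; rewrite ler_wpM2r ?hnorm_ge0.
split=> [x|x e e0]; last first.
  apply/nbhs_hnormP; exists (e / (2 * (gamma * pn))).
    by rewrite divr_gt0 // mulr_gt0.
  move=> y xy h; rewrite /storage_derivative.
  have -> : 2 * gamma * re_inner (P y) h + 2 * re_inner w h -
      (2 * gamma * re_inner (P x) h + 2 * re_inner w h) =
      2 * gamma * re_inner (P (y - x)) h.
    by rewrite linearB re_innerBl; ring.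
  rewrite normrM gtr0_norm ?mulr_gt0 //.
  apply: (@le_trans _ _ (2 * gamma * (pn * hnorm (y - x) * hnorm h))).
    by rewrite ler_pM2l ?Pxy // mulr_gt0.
  rewrite !mulrA ler_wpM2r ?hnorm_ge0 //.
  by rewrite mulrC -ler_pdivlMr ?mulr_gt0 // -mulrA ltW.
split.
- split=> [h h'|a h]; rewrite /storage_derivative.
    by rewrite !re_innerDr; ring.
  by rewrite !re_innerZr; ring.
- pose D := 2 * (gamma * pn) * hnorm x + 2 * hnorm w + 1.
  have D0 : 0 < D by rewrite ltr_wpDl // addr_ge0 // !mulr_ge0 ?hnorm_ge0 // ltW.
  have bound h : `|storage_derivative gamma w x h| <= D * hnorm h.
    apply: le_trans (ler_normD _ _) _.
    rewrite normrM gtr0_norm ?mulr_gt0 // [`|2 * re_inner w h|]normrM normr_nat.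
    have := Cauchy_Schwarz w h; have := hnorm_ge0 h => h0 wh.
    have := ler_wpM2l (ltW g0) (Pxy x h).
    by rewrite /D; lra.
  move=> y A /nbhs_normP[e /= e0 eA]; apply/nbhs_hnormP.
  exists (e / D); first by rewrite divr_gt0.
  move=> y' y'y; apply: eA; rewrite /= distrC.
  have -> : storage_derivative gamma w x y' - storage_derivative gamma w x y =
      storage_derivative gamma w x (y' - y).
    by rewrite /storage_derivative !re_innerBr; ring.
  by apply: le_lt_trans (bound _) _; rewrite mulrC -ltr_pdivlMr.
move=> e e0; apply/nbhs_hnormP; exists (e / (gamma * pn)); first by rewrite divr_gt0.
move=> h; rewrite subr0 => he.
have -> : quadratic_storage (fun x => of_real gamma *: P x) w (x + h) -
    quadratic_storage (fun x => of_real gamma *: P x) w x -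
    storage_derivative gamma w x h = gamma * re_inner (P h) h.
  have Phx : re_inner (P h) x = re_inner (P x) h.
    by rewrite {1}/re_inner P_self_adjoint -/(re_inner _ _) re_innerC.
  rewrite /quadratic_storage /storage_derivative linearD.
  by rewrite !(re_innerZl, re_innerDl, re_innerDr) Phx; ring.
rewrite normrM gtr0_norm //.
apply: (@le_trans _ _ (gamma * (pn * hnorm h * hnorm h))).
  by rewrite ler_pM2l.
rewrite !mulrA ler_wpM2r ?hnorm_ge0 //.
by rewrite mulrC -ler_pdivlMr // ltW.
Qed.

(** Pre-dissipativity speaks of some derivative of the storage function; uniqueness
    identifies it with [storage_derivative]. *)
Lemma frechet_derivative_unique (V : H -> R) x (L1 L2 : H -> R) :
  frechet_derivative V x L1 -> frechet_derivative V x L2 -> L1 =1 L2.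
Proof.
move=> [[_ L1Z] _ V1] [[_ L2Z] _ V2] h.
apply/eqP; rewrite -subr_eq0 -normr_le0.
apply/ler_addgt0Pr => e e0; rewrite add0r.
pose e' := e / (2 * (hnorm h + 1)).
have h1 : 0 < hnorm h + 1 by rewrite ltr_wpDl ?hnorm_ge0.
have e'0 : 0 < e' by rewrite divr_gt0 // mulr_gt0.
have /nbhs_hnormP[d1 d10 dV1] := V1 _ e'0.
have /nbhs_hnormP[d2 d20 dV2] := V2 _ e'0.
pose t := Num.min d1 d2 / (hnorm h + 1).
have t0 : 0 < t by rewrite divr_gt0 // lt_min d10 d20.
have th : hnorm (of_real t *: h - 0) < Num.min d1 d2.
  rewrite subr0 hnormZ gtr0_norm // /t mulrAC ltr_pdivrMr //.
  by rewrite ltr_pM2l ?ltrDl // lt_min d10 d20.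
move: th; rewrite lt_min => /andP[/dV1 b1 /dV2 b2].
move: b1 b2; rewrite L1Z L2Z hnormZ (gtr0_norm t0).
set v := V _ - V _ => b1 b2.
have : `|t * L1 h - t * L2 h| <= e' * (t * hnorm h) + e' * (t * hnorm h).
  have -> : t * L1 h - t * L2 h = (v - t * L2 h) - (v - t * L1 h) by ring.
  by apply: le_trans (ler_normB _ _) _; exact: (lerD b2 b1).
rewrite -mulrBr normrM gtr0_norm // => bt.
rewrite -(ler_pM2l t0); apply: le_trans bt _.
have -> : e = e' * (2 * (hnorm h + 1)) by rewrite /e' divfK // gt_eqF // mulr_gt0.
have : 0 < e' * t by rewrite mulr_gt0.
by lra.
Qed.

End QuadraticStorage.

(** * Strict pre-dissipativity and the operator inequality *)

(** The estimate behind [graph_coercive], with [a], [u], [y] the norms of [x], [u] and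
    [A x + B u], [b] a bound for [B] and [s] one for [eta * P].  Young's inequality
    absorbs [a * r] into [m * a ^+ 2], after which [Csq], [Ksq] and [y ^+ 2] bound the
    rest; the constant is the sum of their three coefficients. *)
Lemma coercivity_estimate (R : realType) (m kk s b a u y Csq Ksq r : R) :
  0 < m -> 0 < kk ->
  kk * u ^+ 2 <= Ksq -> 0 <= Csq -> 0 <= Ksq ->
  m * a ^+ 2 <= Csq + 2 * a * r ->
  r ^+ 2 <= 2 * s ^+ 2 * y ^+ 2 + 2 * (s * b) ^+ 2 * u ^+ 2 ->
  a ^+ 2 + u ^+ 2 + y ^+ 2 <=
  (2 / m + (8 * (s / m) ^+ 2 * b ^+ 2 + 1) / kk + (8 * (s / m) ^+ 2 + 1)) *
  (Csq + Ksq + y ^+ 2).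
Proof.
move=> m0 k0 hK C0 K0 hm hr.
have a2 : a ^+ 2 <= 2 / m * Csq + 4 * (r / m) ^+ 2.
  have := sqr_ge0 (a - 2 * (r / m)) => sq.
  have : a ^+ 2 <= Csq / m + 2 * a * (r / m).
    have -> : Csq / m + 2 * a * (r / m) = (Csq + 2 * a * r) / m by ring.
    by rewrite ler_pdivlMr // mulrC.
  lra.
have r2 : (r / m) ^+ 2 <=
    2 * (s / m) ^+ 2 * y ^+ 2 + 2 * (s / m) ^+ 2 * b ^+ 2 * u ^+ 2.
  have -> : 2 * (s / m) ^+ 2 * y ^+ 2 + 2 * (s / m) ^+ 2 * b ^+ 2 * u ^+ 2 =
    (2 * s ^+ 2 * y ^+ 2 + 2 * (s * b) ^+ 2 * u ^+ 2) / m ^+ 2.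
    by rewrite !exprMn exprVn; ring.
  by rewrite exprMn exprVn ler_wpM2r // invr_ge0 sqr_ge0.
have u2 : u ^+ 2 <= Ksq / kk by rewrite ler_pdivlMr // mulrC.
have E0 : 0 <= 8 * (s / m) ^+ 2 * b ^+ 2 + 1.
  by rewrite addr_ge0 // mulr_ge0 ?sqr_ge0 // mulr_ge0 ?sqr_ge0.
have := ler_wpM2l E0 u2.
have m'0 : 0 < 2 / m by rewrite divr_gt0.
have k'0 : 0 <= (8 * (s / m) ^+ 2 * b ^+ 2 + 1) / kk.
  by apply: divr_ge0 => //; exact: ltW.
have y'0 : 0 <= 8 * (s / m) ^+ 2 + 1 by rewrite addr_ge0 // mulr_ge0 ?sqr_ge0.
have y0 := sqr_ge0 y.
have -> : (8 * (s / m) ^+ 2 * b ^+ 2 + 1) * (Ksq / kk) =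
  (8 * (s / m) ^+ 2 * b ^+ 2 + 1) / kk * Ksq by ring.
move: m'0 k'0 y'0 r2 a2; set c1 := 2 / m; set c2 := (_ / kk); set c3 := (s / m) ^+ 2.
move=> m'0 k'0 y'0 r2 a2 h.
have : 0 <= c1 * Ksq + c1 * y ^+ 2 + c2 * Csq + c2 * y ^+ 2 +
    (8 * c3 + 1) * Csq + (8 * c3 + 1) * Ksq.
  by rewrite !addr_ge0 // mulr_ge0 // ltW.
by lra.
Qed.

Section OptimalControl.
Context {R : realType} {k : scalar_kind} {H U Y Z : hilbertType R k}.
Variables (domA : set H) (A : H -> H).
Variables (B : {linear U -> H}) (C : {linear H -> Y}) (K : {linear U -> Z}).
Variables (z : H) (v : U) (P : {linear H -> H}).
Variables (bn cn kn pn cK kk : R).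
Hypothesis genA : generates_C0_semigroup domA A.
Hypotheses (bn0 : 0 < bn) (cn0 : 0 < cn) (kn0 : 0 < kn) (pn0 : 0 < pn).
Hypotheses (B_bounded : bounded_operator B bn) (C_bounded : bounded_operator C cn).
Hypotheses (K_bounded : bounded_operator K kn) (P_bounded : bounded_operator P pn).
Hypotheses (cK0 : 0 < cK) (BK : forall u, cK * hnorm (B u) <= hnorm (K u)).
Hypothesis P_self_adjoint : self_adjoint P.
Hypothesis kk0 : 0 < kk.
Hypothesis K_coercive : forall u, kk * hnorm u ^+ 2 <= hnorm (K u) ^+ 2.
Hypothesis ran_closed :
  closed [set y : H | exists x u, domA x /\ y = A x + B u].

Local Notation ell := (stage_cost C K z v).
Local Notation storage gamma w :=
  (quadratic_storage (fun x => of_real gamma *: P x) w).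

(** Half of the derivative of the stage cost at [(x, u)] in the direction
    [(x', u')]. *)
Definition stage_derivative (x : H) (u : U) (x' : H) (u' : U) : R :=
  re_inner (C x) (C x') + re_inner (K u) (K u') + re_inner z x' + re_inner v u'.

Lemma stage_costB xe ue x u :
  ell x u - ell xe ue = 2 * stage_derivative xe ue (x - xe) (u - ue) +
    hnorm (C (x - xe)) ^+ 2 + hnorm (K (u - ue)) ^+ 2.
Proof.
rewrite /stage_cost /stage_derivative !linearB -!re_inner_hnorm.
rewrite !(re_innerBl, re_innerBr) (re_innerC (C x) (C xe)) (re_innerC (K u) (K ue)).
ring.
Qed.

Lemma generatorB x y : domA x -> domA y ->
  domA (x - y) /\ A (x - y) = A x - A y.
Proof.
move=> dx dy; have [dy' Ay'] := generatorZ genA (-1) dy.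
by rewrite -!of_realN1 -Ay'; exact: generatorD.
Qed.

Section Sufficiency.
Variables (eta m : R).
Hypotheses (eta0 : 0 < eta) (m0 : 0 < m).
Hypothesis op_ineq : forall x, domA x ->
  m * hnorm x ^+ 2 <= hnorm (C x) ^+ 2 - 2 * eta * re_inner (A x) (P x).

(** The operator inequality makes the stage cost coercive in [x] as well, up to the
    violation [A x + B u] of the steady state equation: replacing [A x] by
    [(A x + B u) - B u] leaves only terms of first order in [x]. *)
Lemma graph_coercive : exists2 L : R, 0 < L & forall x u, domA x ->
  hnorm x ^+ 2 + hnorm u ^+ 2 + hnorm (A x + B u) ^+ 2 <=
  L * (hnorm (C x) ^+ 2 + hnorm (K u) ^+ 2 + hnorm (A x + B u) ^+ 2).
Proof.
pose s := eta * pn.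
exists (2 / m + (8 * (s / m) ^+ 2 * bn ^+ 2 + 1) / kk + (8 * (s / m) ^+ 2 + 1)).
  have sm := sqr_ge0 (s / m); have b2 := sqr_ge0 bn.
  have h1 : 0 < 2 / m by rewrite divr_gt0.
  have h2 : 0 <= (8 * (s / m) ^+ 2 * bn ^+ 2 + 1) / kk.
    by apply: divr_ge0; [rewrite addr_ge0 // mulr_ge0 // mulr_ge0 | exact: ltW].
  by lra.
move=> x u dx.
apply: (@coercivity_estimate _ _ _ _ _ _ _ _ _ _
  (s * (hnorm (A x + B u) + bn * hnorm u))) => //;
  rewrite ?hnorm_ge0 ?sqr_ge0 //; last first.
  have := sqr_ge0 (s * hnorm (A x + B u) - s * bn * hnorm u); lra.
apply: le_trans (op_ineq dx) _; rewrite lerD2l.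
have -> : re_inner (A x) (P x) = re_inner (A x + B u) (P x) - re_inner (B u) (P x).
  by rewrite re_innerDl addrK.
have h1 := Cauchy_Schwarz (A x + B u) (P x); have h2 := Cauchy_Schwarz (B u) (P x).
have h3 := ler_wpM2l (hnorm_ge0 (A x + B u)) (P_bounded x).
have h4 : hnorm (B u) * hnorm (P x) <= bn * hnorm u * (pn * hnorm x).
  by rewrite ler_pM ?hnorm_ge0.
have h5 : - re_inner (A x + B u) (P x) <= hnorm (A x + B u) * (pn * hnorm x).
  by apply: le_trans h3; apply: le_trans h1; rewrite -normrN ler_norm.
have h6 : re_inner (B u) (P x) <= bn * hnorm u * (pn * hnorm x).
  by apply: le_trans h4; apply: le_trans h2; rewrite ler_norm.
have := ler_wpM2l (ltW eta0) (lerD h5 h6); rewrite /s; lra.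
Qed.

(** [Lagrange_multiplier] on the graph of [(x, u) |-> A x + B u], which is closed
    because [A] is closed and [B] is bounded. *)
Lemma steady_state_multiplier : exists xe ue w,
  [/\ domA xe, A xe + B ue = 0 & forall x u, domA x ->
      re_inner w (A x + B u) = stage_derivative xe ue x u].
Proof.
have [L L0 LP] := graph_coercive.
pose X := (H * U * H)%type.
pose G : set X := [set p | domA p.1.1 /\ p.2 = A p.1.1 + B p.1.2].
pose c (p h : X) := re_inner (C p.1.1) (C h.1.1) + re_inner (K p.1.2) (K h.1.2).
pose l (p : X) := re_inner z p.1.1 + re_inner v p.1.2.
pose M := 2 * (hnorm z ^+ 2 + hnorm v ^+ 2) + 1.
have GB (p p' : X) : G p -> G p' -> G (p - p').
  move=> [dp Ep] [dp' Ep']; have [d E] := generatorB dp dp'.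
  by split=> //=; rewrite E Ep Ep' linearB opprD addrACA.
have D0 : 0 < cn ^+ 2 + kn ^+ 2 by rewrite addr_gt0 // exprn_gt0.
have M0 : 0 < M by rewrite ltr_wpDl // mulr_ge0 // addr_ge0 // sqr_ge0.
have subG : real_subspace G.
  have [d0 _ _] := generator_subspace genA.
  split=> [|p p' [dp Ep] [dp' Ep']|a p [dp Ep]].
  (* A 0 = 0 is read off the difference of a point of G with itself *)
  - have [_ E] := GB (0, 0, B 0 + A 0) (0, 0, B 0 + A 0)
      (conj d0 (addrC _ _)) (conj d0 (addrC _ _)).
    by split=> //; move: E; rewrite /= !subrr.
  - have [d E] := generatorD genA dp dp'.
    by split=> //=; rewrite E Ep Ep' linearD addrACA.
  - have [d E] := generatorZ genA a dp.
    by split=> //=; rewrite E Ep linearZ scalerDr.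
have closedG p :
    (forall e : R, 0 < e -> exists2 p', G p' & sqr_norm (p' - p) < e) -> G p.
  move=> approx.
  have [|dp Ap] := generator_closed genA (x := p.1.1) (y := p.2 - B p.1.2).
    move=> e e0; pose e' := e / (1 + bn).
    have e'0 : 0 < e' by rewrite divr_gt0 // addr_gt0.
    have e'e : e' + bn * e' = e by rewrite /e'; field; rewrite gt_eqF // addr_gt0.
    have [p' [dp' Ep']] := approx _ (exprn_gt0 2 e'0); rewrite /sqr_norm /=.
    have := sqr_ge0 (hnorm (p'.1.1 - p.1.1)).
    have := sqr_ge0 (hnorm (p'.1.2 - p.1.2)); have := sqr_ge0 (hnorm (p'.2 - p.2)).
    move=> y0 u0 x0 sum.
    have small (E : hilbertType R k) (f : E) : hnorm f ^+ 2 < e' ^+ 2 -> hnorm f < e'.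
      by rewrite ltr_sqr // nnegrE ?hnorm_ge0 // ltW.
    have xe : hnorm (p'.1.1 - p.1.1) < e' by apply: small; lra.
    have ue : hnorm (p'.1.2 - p.1.2) < e' by apply: small; lra.
    have ye : hnorm (p'.2 - p.2) < e' by apply: small; lra.
    have be : 0 < bn * e' by rewrite mulr_gt0.
    exists p'.1.1 => //; split; first lra.
    have -> : A p'.1.1 - (p.2 - B p.1.2) = (p'.2 - p.2) - B (p'.1.2 - p.1.2).
      rewrite Ep' (linearB B) !opprB [RHS]addrAC (addrC (B p.1.2) (- B _)).
      by rewrite (addrA _ (- B _)) addrK addrA.
    apply: le_lt_trans (ler_hnormD _ _) _; rewrite hnorm_opp.
    have := B_bounded (p'.1.2 - p.1.2); have := ler_wpM2l (ltW bn0) (ltW ue).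
    by lra.
  by split=> //; rewrite Ap subrK.
have [||||||||||p [w [[dp Ep] p0 wP]]] :=
  @Lagrange_multiplier R k H U G c l L M _ subG closedG _ _ _ _ _ _ D0 L0 M0.
- suff -> : [set p.2 | p in G] = [set y | exists x u, domA x /\ y = A x + B u] by [].
  apply/seteqP; split=> [_ [p [dp Ep] <-]|y [x [u [dx yE]]]].
    by exists p.1.1, p.1.2.
  by exists (x, u, y).
- by move=> p p' h; rewrite /c /= !linearD !re_innerDl; ring.
- by move=> a p h; rewrite /c /= !linearZ !re_innerZl; ring.
- by move=> p h; rewrite /c re_innerC (re_innerC (K _)).
- by move=> p p'; rewrite /l /= !re_innerDr; ring.
- by move=> a p; rewrite /l /= !re_innerZr; ring.
- by move=> p; rewrite /c !re_inner_hnorm addr_ge0 // sqr_ge0.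
- move=> p; rewrite /c /sqr_norm !re_inner_hnorm.
  have sqr_le (E F : hilbertType R k) (T : {linear E -> F}) b x : 0 < b ->
      bounded_operator T b -> hnorm (T x) ^+ 2 <= b ^+ 2 * hnorm x ^+ 2.
    move=> b0 Tb; rewrite -exprMn ler_sqr ?Tb // nnegrE ?hnorm_ge0 //.
    by rewrite mulr_ge0 ?hnorm_ge0 // ltW.
  have := sqr_le _ _ _ _ p.1.1 cn0 C_bounded.
  have := sqr_le _ _ _ _ p.1.2 kn0 K_bounded.
  have := mulr_ge0 (sqr_ge0 kn) (sqr_ge0 (hnorm p.1.1)).
  have := mulr_ge0 (sqr_ge0 cn) (sqr_ge0 (hnorm p.1.2)).
  have := mulr_ge0 (ltW D0) (sqr_ge0 (hnorm p.2)); lra.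
- move=> p; rewrite /l /M /sqr_norm.
  have := Cauchy_Schwarz_sqr z p.1.1; have := Cauchy_Schwarz_sqr v p.1.2.
  have := sqr_ge0 (re_inner z p.1.1 - re_inner v p.1.2).
  have := mulr_ge0 (sqr_ge0 (hnorm v)) (sqr_ge0 (hnorm p.1.1)).
  have := mulr_ge0 (sqr_ge0 (hnorm z)) (sqr_ge0 (hnorm p.1.2)).
  have := mulr_ge0 (sqr_ge0 (hnorm v)) (sqr_ge0 (hnorm p.2)).
  have := mulr_ge0 (sqr_ge0 (hnorm z)) (sqr_ge0 (hnorm p.2)).
  have := sqr_ge0 (hnorm p.1.1); have := sqr_ge0 (hnorm p.1.2).
  have := sqr_ge0 (hnorm p.2); lra.
- by move=> p [dp Ep]; rewrite /c /sqr_norm !re_inner_hnorm Ep; exact: LP.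
exists p.1.1, p.1.2, w; split=> // [|x u dx]; first by rewrite -Ep.
by rewrite (wP (x, u, A x + B u)) // /c /l /stage_derivative !addrA.
Qed.

(** Because the cost is quadratic, its first order term at the optimum is exactly
    the multiplier term, and what remains is a sum of squares. *)
Lemma multiplier_stage_cost xe ue w : domA xe -> A xe + B ue = 0 ->
  (forall x u, domA x -> re_inner w (A x + B u) = stage_derivative xe ue x u) ->
  forall x u, domA x ->
    [/\ domA (x - xe), A x + B u = A (x - xe) + B (u - ue)
      & ell x u - ell xe ue = 2 * re_inner w (A x + B u) +
          hnorm (C (x - xe)) ^+ 2 + hnorm (K (u - ue)) ^+ 2].
Proof.
move=> dxe eqe wP x u dx; have [d E] := generatorB dx dxe.
have EE : A x + B u = A (x - xe) + B (u - ue).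
  by rewrite E linearB addrACA -opprD eqe subr0.
by split=> //; rewrite EE wP // stage_costB.
Qed.

Lemma multiplier_steady_state_minimizer xe ue w : domA xe -> A xe + B ue = 0 ->
  (forall x u, domA x -> re_inner w (A x + B u) = stage_derivative xe ue x u) ->
  steady_state_minimizer domA A B ell xe ue /\
  forall x u, steady_state_minimizer domA A B ell x u -> x = xe /\ u = ue.
Proof.
move=> dxe eqe wP; have expand := multiplier_stage_cost dxe eqe wP.
split=> [|x u [[dx Exu] min_xu]].
  split=> // x u [dx Exu]; have [_ _] := expand _ u dx.
  rewrite Exu re_inner0r.
  have := sqr_ge0 (hnorm (C (x - xe))); have := sqr_ge0 (hnorm (K (u - ue))); lra.
have [d E] := expand _ u dx; have le := min_xu xe ue (conj dxe eqe).
rewrite Exu re_inner0r => ellE.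
have [L L0 /(_ _ (u - ue) d)] := graph_coercive.
rewrite -E Exu hnorm0 expr0n /= !addr0 => coer.
have le0 : hnorm (x - xe) ^+ 2 + hnorm (u - ue) ^+ 2 <= 0.
  by apply: le_trans coer _; rewrite pmulr_rle0 //; lra.
have := sqr_ge0 (hnorm (x - xe)); have := sqr_ge0 (hnorm (u - ue)) => u0 x0.
by split; apply/eqP; rewrite -subr_eq0; apply/eqP/hnorm_sqr_le0; lra.
Qed.

(** The linear part [w - gamma P xe] of the storage function cancels the multiplier
    term of the cost and recentres its quadratic part at [xe].  What remains to be
    shown involves only [x - xe] and [u - ue]; there [gamma = lam * eta] with [lam] so
    small that the cross term [<P (x - xe), B (u - ue)>] is absorbed by
    [|K (u - ue)|^2], which dominates [B], and by a part of the operator inequality. *)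
Lemma multiplier_pre_dissipative xe ue w : domA xe -> A xe + B ue = 0 ->
  (forall x u, domA x -> re_inner w (A x + B u) = stage_derivative xe ue x u) ->
  exists gamma w', 0 < gamma /\
    strictly_pre_dissipative domA A B ell xe ue (storage gamma w').
Proof.
move=> dxe eqe wP; have expand := multiplier_stage_cost dxe eqe wP.
pose mu := eta * pn / cK.
have mu0 : 0 < mu by rewrite divr_gt0 // mulr_gt0.
(* lam <= 1 keeps the weight of |C dx'|^2, the second bound leaves lam * m / 2 *)
pose lam := Num.min 1 (m / (2 * mu ^+ 2)).
have lam0 : 0 < lam by rewrite lt_min ltr01 divr_gt0 // mulr_gt0 // exprn_gt0.
have lam1 : lam <= 1 by rewrite /lam ge_min lexx.
have lam_mu : lam * (2 * mu ^+ 2) <= m.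
  by rewrite -ler_pdivlMr /lam ?ge_min ?lexx ?orbT // mulr_gt0 // exprn_gt0.
pose gamma := lam * eta.
have gamma0 : 0 < gamma by rewrite mulr_gt0.
exists gamma, (w - of_real gamma *: P xe); split=> //; split=> //.
exists (storage_derivative P gamma (w - of_real gamma *: P xe)).
exists (fun r => lam * m / 2 * r ^+ 2); split.
- exact: (storage_derivativeP pn0).
- have q0 : 0 < lam * m / 2 by rewrite divr_gt0 // mulr_gt0.
  split=> [|r r0|r s r0 rs|].
  + apply: continuous_subspaceT => r.
    by apply: cvgM; [exact: cvg_cst | exact: (cvgM cvg_id cvg_id)].
  + by rewrite mulr_ge0 ?sqr_ge0 // ltW.
  + by rewrite ltr_pM2l // ltr_sqr // nnegrE // (le_trans r0) // ltW.
  + by rewrite expr0n mulr0.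
- move=> x u dx; have [d E ->] := expand _ u dx.
  set dx' := x - xe in d E *; set du := u - ue in E *.
  have -> : storage_derivative P gamma (w - of_real gamma *: P xe) x (A x + B u) =
      2 * gamma * (re_inner (A dx') (P dx') + re_inner (P dx') (B du)) +
      2 * re_inner w (A x + B u).
    rewrite (re_innerC (A dx')) -re_innerDr -E /storage_derivative /dx' linearB.
    by rewrite !re_innerBl re_innerZl; ring.
  have hop := op_ineq d.
  have cs : re_inner (P dx') (B du) <= pn * hnorm dx' * (hnorm (K du) / cK).
    apply: le_trans (ler_norm _) _; apply: le_trans (Cauchy_Schwarz _ _) _.
    by rewrite ler_pM ?hnorm_ge0 ?P_bounded // ler_pdivlMr // mulrC.
  have {}cs : eta * re_inner (P dx') (B du) <= mu * hnorm dx' * hnorm (K du).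
    have := ler_wpM2l (ltW eta0) cs; congr (_ <= _); rewrite /mu; ring.
  have := ler_wpM2l (ltW lam0) cs; have := ler_wpM2l (ltW lam0) hop.
  have := ler_wpM2r (sqr_ge0 (hnorm (C dx'))) lam1.
  have := sqr_ge0 (hnorm (K du) - lam * mu * hnorm dx').
  have := ler_wpM2r (sqr_ge0 (hnorm dx')) (ler_wpM2l (ltW lam0) lam_mu).
  by rewrite /gamma; lra.
Qed.

End Sufficiency.

(** Along [xe + h] and [xe - h] with the control [ue] fixed, the terms of first order
    in [h] cancel in the sum of the two dissipation inequalities and leave
    [alpha (|h|) <= |C h|^2 - 2 gamma Re <A h, P h>].  The right-hand side is
    homogeneous of degree two, so its values on the unit sphere, which are at least
    [alpha 1], decide. *)
Lemma pre_dissipative_operator_inequality gamma w xe ue : 0 < gamma ->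
  strictly_pre_dissipative domA A B ell xe ue (storage gamma w) ->
  exists eta m : R, [/\ 0 < eta, 0 < m & forall x, domA x ->
    m * hnorm x ^+ 2 <= hnorm (C x) ^+ 2 - 2 * eta * re_inner (A x) (P x)].
Proof.
move=> gamma0 [[dxe eqe] [V' [alpha [[V'P _] [_ _ alpha_mono alpha0] diss]]]].
have [VP _] := storage_derivativeP pn0 P_bounded P_self_adjoint w gamma0.
have {V'P VP}diss' x u : domA x -> storage_derivative P gamma w x (A x + B u) <=
    ell x u - ell xe ue - alpha (hnorm (x - xe)).
  move=> dx; rewrite -(frechet_derivative_unique (V'P x) (VP x)); exact: diss.
have a1 : 0 < alpha 1 by rewrite -alpha0 alpha_mono.
exists gamma, (alpha 1); split=> //.
have main h : domA h ->
    alpha (hnorm h) <= hnorm (C h) ^+ 2 - 2 * gamma * re_inner (A h) (P h).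
  move=> dh.
  have [dp Ep] := generatorD genA dxe dh; have [dm Em] := generatorB dxe dh.
  have := diss' _ ue dp; have := diss' _ ue dm.
  rewrite Ep Em (addrAC (A xe) (A h)) (addrAC (A xe) (- A h)) eqe !add0r.
  rewrite !stage_costB subrr linear0.
  rewrite (addrAC xe h) (addrAC xe (- h)) subrr !add0r linearN !hnorm_opp.
  rewrite /stage_derivative.
  rewrite /storage_derivative !(linearD P) ?linear0 ?linearN.
  rewrite !(re_innerDl, re_innerNl, re_innerNr, re_inner0r) hnorm0 expr0n /=.
  by rewrite (re_innerC (A h)); lra.
move=> x dx; have [x0|xn0] := eqVneq (hnorm x) 0.
  have := main _ dx; rewrite x0 alpha0 expr0n mulr0; exact.
have x0 : 0 < hnorm x by rewrite lt_neqAle eq_sym xn0 hnorm_ge0.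
have [ds Es] := generatorZ genA (hnorm x)^-1 dx.
have := main _ ds; rewrite Es.
rewrite (linearZ_LR C) (linearZ_LR P) /= !hnormZ re_innerZl re_innerZr.
rewrite gtr0_norm ?invr_gt0 // mulVf // exprMn => unit_ineq.
rewrite mulrC -ler_pdivlMl ?exprn_gt0 //; apply: le_trans unit_ineq _.
by rewrite le_eqVlt; apply/orP; left; apply/eqP; rewrite -exprVn; ring.
Qed.

End OptimalControl.

Theorem theorem11 (R : realType) (k : scalar_kind) (H U Y Z : hilbertType R k)
    (domA : set H) (A : H -> H)
    (B : {linear U -> H}) (C : {linear H -> Y}) (K : {linear U -> Z})
    (z : H) (v : U) (P : {linear H -> H}) :
  generates_C0_semigroup domA A ->
  continuous B -> continuous C -> continuous K ->
  (exists2 cK : R, 0 < cK & forall u, cK * hnorm (B u) <= hnorm (K u)) ->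
  continuous P -> self_adjoint P ->
  coercive K ->
  closed [set y : H | exists x u, domA x /\ y = A x + B u] ->
  let ell := stage_cost C K z v in
  let operator_inequality :=
    exists eta m : R, [/\ 0 < eta, 0 < m & forall x, domA x ->
      m * hnorm x ^+ 2 <= hnorm (C x) ^+ 2 - 2 * eta * re_inner (A x) (P x)] in
  ((exists (gamma : R) (w : H), 0 < gamma /\
      exists (xe : H) (ue : U),
        strictly_pre_dissipative domA A B ell xe ue
          (quadratic_storage (fun x => of_real gamma *: P x) w))
   <-> operator_inequality)
  /\
  (operator_inequality ->
   exists (xe : H) (ue : U),
     [/\ steady_state_minimizer domA A B ell xe ue,
         (forall x u, steady_state_minimizer domA A B ell x u ->
            x = xe /\ u = ue)
       & exists (gamma : R) (w : H), 0 < gamma /\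
           strictly_pre_dissipative domA A B ell xe ue
             (quadratic_storage (fun x => of_real gamma *: P x) w)]).
Proof.
move=> genA cB cC cK_ [cK cK0 BK] cP Psa [K' [_ adjK [kk kk0 KK]]] ranC ell op.
have [bn bn0 Bb] := continuous_bounded_operator cB.
have [cn cn0 Cb] := continuous_bounded_operator cC.
have [kn kn0 Kb] := continuous_bounded_operator cK_.
have [pn pn0 Pb] := continuous_bounded_operator cP.
have K_coercive u : kk * hnorm u ^+ 2 <= hnorm (K u) ^+ 2.
  apply: le_trans (KK u) _.
  by rewrite /= re_innerC /re_inner -adjK -/(re_inner _ _) re_inner_hnorm.
have sufficiency : op -> exists xe ue, [/\ steady_state_minimizer domA A B ell xe ue,
    (forall x u, steady_state_minimizer domA A B ell x u -> x = xe /\ u = ue)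
  & exists gamma w, 0 < gamma /\ strictly_pre_dissipative domA A B ell xe ue
      (quadratic_storage (fun x => of_real gamma *: P x) w)].
  move=> [eta [m [eta0 m0 op_ineq]]].
  have [xe [ue [w [dxe eqe wP]]]] := steady_state_multiplier z v genA bn0 cn0 kn0
    Bb Cb Kb Pb kk0 K_coercive ranC eta0 m0 op_ineq.
  have [min uniq] := multiplier_steady_state_minimizer genA Bb Pb kk0
    K_coercive eta0 m0 op_ineq dxe eqe wP.
  exists xe, ue; split=> //.
  exact: (multiplier_pre_dissipative genA pn0 Pb cK0 BK Psa eta0 m0 op_ineq dxe eqe wP).
split=> //; split=> [[gamma [w [gamma0 [xe [ue diss]]]]]|].
  exact: (pre_dissipative_operator_inequality genA pn0 Pb Psa gamma0 diss).
by move=> /sufficiency[xe [ue [_ _ [gamma [w [gamma0 diss]]]]]]; 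
  exists gamma, w; split=> //; exists xe, ue.
Qed.
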